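(* Let $H(x,\xi;s)$ be a smooth one-parameter family of Hamiltonians, $|s|\ll1$, as in the context. Assume that $x_1,x_2\in M$ are not conjugate along the bicharacteristic issued from $(x_1,\xi^1)$ related to $H(x,\xi;0)$. Let $[0,1]\ni t\mapsto(x(t;s),\xi(t;s))$ be Hamiltonian curves related to $H(x,\xi;s)$, smoothly dependent on $s$ for $|s|\ll1$ (with $(x(0;0),\xi(0;0))=(x_1,\xi^1)$), such that their $x$-projections connect $x_1$ and $x_2$, i.e. $x(0;s)=x_1$, $x(1;s)=x_2$. Let $T(x_1,x_2;s)$ be the corresponding travel times. Then $$\frac{\partial}{\partial s}\Big|_{s=0}\frac12T^2(x_1,x_2;s)=-\int_0^1H_s(x(t;0),\xi(t;0);0)\,\mathrm dt .$$ Parameterizing the bicharacteristics as unit ones, i.e. now letting $[0,T(x_1,x_2;0)]\ni t\mapsto(x(t;0),\xi(t;0))$ denote the corresponding Hamiltonian curve of $H(\cdot,\cdot;0)$ from $x_1$ to $x_2$ at energy level $1/2$, one has $$\frac{\partial}{\partial s}\Big|_{s=0}T(x_1,x_2;s)=-\int_0^{T(x_1,x_2;0)}H_s(x(t;0),\xi(t;0);0)\,\mathrm dt .$$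
   Context: $M$ is a smooth manifold, possibly with boundary, $\dim M=n\ge2$. Each $H(\cdot,\cdot;s)\in C^\infty(T^*M\setminus0)$ is positive, homogeneous of degree two in $\xi$ ($H(x,\lambda\xi;s)=\lambda^2H(x,\xi;s)$, $\lambda>0$), with $\mathrm dH\neq0$ on $\{H=1/2\}$. Hamiltonian curves (bicharacteristics) solve $\dot x=H_\xi$, $\dot\xi=-H_x$; they are unit if on energy level $H=1/2$. Set $|\xi|_x=(2H(x,\xi))^{1/2}$. For a Hamiltonian $H$ with flow $\Phi^t$, the exponential map is $\exp_x\xi=\pi\circ\Phi^1(x,\xi)$, $\pi:T^*M\to M$. A point $y=\exp_x\xi$ is not conjugate to $x$ along the bicharacteristic issued from $(x,\xi)$ if $\exp_x$ is a local diffeomorphism near $\xi$; then the travel time between $x$ and $y$ is $T(x,y)=|\xi|_x$ (the time needed to go from $x$ to $y$ along the corresponding unit bicharacteristic); it is locally defined, for the locally unique bicharacteristic near the given one. In the claim $T(x_1,x_2;s)$ is the travel time for $H(\cdot,\cdot;s)$ along the curve $(x(\cdot;s),\xi(\cdot;s))$, i.e. $T(x_1,x_2;s)=(2H(x_1,\xi(0;s);s))^{1/2}$. $H_s$ is the partial derivative of $H$ in its last argument. *)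

(* Defs.v *)
From HB Require Import structures.
From mathcomp Require Import all_boot all_order all_algebra.
From mathcomp Require Import all_classical all_reals all_analysis.
From mathcomp Require Import lra.

Set Implicit Arguments.
Unset Strict Implicit.
Unset Printing Implicit Defensive.

Import Order.TTheory GRing.Theory Num.Theory.
Import numFieldNormedType.Exports.

Local Open Scope classical_set_scope.
Local Open Scope ring_scope.

Section Calculus.
Context {R : realType}.

(* Used for finite-dimensional V only, where differentiating the differential
   amounts to differentiating all the directional derivatives. *)
Fixpoint Ck {V W : normedModType R} (k : nat) (U : set V) (f : V -> W) : Prop :=
  if k is k'.+1 then
    (forall x, U x -> differentiable f x) /\
    (forall v, Ck k' U (fun x => 'D_v f x))
  else forall x, U x -> {for x, continuous f}.

(* Smoothness on an arbitrary set A: f is locally the restriction to A of a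
   smooth function defined on an open set. *)
Definition smooth_on {V W : normedModType R} (A : set V) (f : V -> W) : Prop :=
  forall x, A x -> exists U g, [/\ open U, U x, forall k, Ck k U g &
    forall y, A y -> U y -> f y = g y].

(* L is the differential at x of a function differentiable at x that coincides
   with f on A near x. It is uniquely determined by f for the sets A used below:
   relatively open subsets of a half-space (see diff_on_unique), their products
   with open sets, and nondegenerate intervals. *)
Definition diff_on {V W : normedModType R} (A : set V) (f : V -> W) (x : V)
    (L : V -> W) : Prop :=
  exists g : V -> W, [/\ differentiable g x,
    (\forall y \near within A (nbhs x), f y = g y) & L = 'd g x :> (V -> W)].

Definition halfspace {n : nat} : set 'rV[R]_n :=
  [set u | forall k : 'I_n, k = 0%N :> nat -> 0 <= u 0 k].

Lemma smooth_on_diff {V W : normedModType R} (A : set V) (f : V -> W) x :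
  smooth_on A f -> A x -> exists L : {linear V -> W}, diff_on A f x L.
Proof.
move=> sf Ax; have [U [g [oU Ux sg fg]]] := sf x Ax.
exists ('d g x); exists g; split=> //; first by have [+ _] := sg 1%N; apply.
rewrite near_withinE; near=> y => Ay; apply: fg => //.
by near: y; exact: open_nbhs_nbhs.
Unshelve. all: by end_near. Qed.

Lemma diff_onW {V W : normedModType R} (A B : set V) (f g : V -> W) x L :
  A `<=` B -> (forall y, A y -> f y = g y) -> diff_on B f x L -> diff_on A g x L.
Proof.
move=> AB fg [h [dh fh ->]]; exists h; split=> //; move: fh.
rewrite !near_withinE; apply: filterS => y fh Ay.
by rewrite -fg // fh //; exact: AB.
Qed.

Lemma diff_on_unique (n : nat) (W : normedModType R) (O : set 'rV[R]_n)
    (f : 'rV[R]_n -> W) (x : 'rV[R]_n) (L1 L2 : 'rV[R]_n -> W) :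
  open O -> (O `&` halfspace) x ->
  diff_on (O `&` halfspace) f x L1 -> diff_on (O `&` halfspace) f x L2 ->
  L1 = L2.
Proof.
move=> oO [Ox hx] [g1 [dg1 e1 ->]] [g2 [dg2 e2 ->]].
pose v0 : 'rV[R]_n := const_mx 1.
have half v : halfspace v -> 'd g1 x v = 'd g2 x v.
  move=> hv; apply/eqP; rewrite -subr_eq0; apply/eqP.
  pose g := g1 - g2.
  have dg : differentiable g x by exact: differentiableB.
  have -> : 'd g1 x v - 'd g2 x v = 'D_v g x.
    by rewrite deriveB ?deriveE //; apply: diff_derivable.
  have gx0 : \forall y \near nbhs x, halfspace y -> g y = 0.
    move: e1 e2; rewrite !near_withinE => e1 e2; near=> y => hy.
    have Ay : (O `&` halfspace) y.
      by split=> //; near: y; exact: open_nbhs_nbhs.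
    have /(_ Ay) fg1 : (O `&` halfspace) y -> f y = g1 y by near: y.
    have /(_ Ay) fg2 : (O `&` halfspace) y -> f y = g2 y by near: y.
    by rewrite /g !fctE -fg1 -fg2 subrr.
  have dv : derivable g x v by exact: diff_derivable.
  have cv0 : (h^-1 *: ((g \o shift x) (h *: v) - g x)) @[h --> 0^'+] --> 'D_v g x.
    exact: cvg_dnbhs_at_right dv.
  apply/esym; apply: (cvg_unique _ _ cv0) => //.
  apply: cvg_near_cst.
  have cy : (h *: v + x) @[h --> 0^'+] --> x.
    rewrite -[X in _ --> X]add0r -(scale0r v).
    apply: cvgD; last exact: cvg_cst.
    by apply: cvgZr_tmp; apply: cvg_at_right_filter; exact: cvg_id.
  have g0 : g x = 0 by apply: (nbhs_singleton gx0).
  near=> h; rewrite /= g0 subr0.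
  have -> : g (h *: v + x) = 0; last by rewrite scaler0.
  have : halfspace (h *: v + x).
    move=> k k0; rewrite !mxE; apply: addr_ge0; last exact: hx.
    by apply: mulr_ge0; [near: h; exact: nbhs_right_ge | exact: hv].
  by near: h; exact: (cy _ gx0).
apply/funext => v.
pose w : 'rV[R]_n := map_mx (fun a => `|a|) v.
have -> : v = (v + w) - w by rewrite addrK.
rewrite !linearB; congr (_ - _); apply: half => k _; rewrite !mxE //.
by have := ler_norm (- v 0 k); rewrite normrN; lra.
Unshelve. all: by end_near. Qed.

End Calculus.

(* A smooth manifold with (possibly empty) boundary, of dimension n, presented
   by an atlas of charts onto relatively open subsets of the half-space; the
   atlas need not be maximal. coordV i is inverse to coord i; coord i and
   coordV i are unconstrained outside dom i and its image. *)
Record manifold (R : realType) (n : nat) := Manifold {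
  carrier :> topologicalType ;
  manifold_hausdorff : hausdorff_space carrier ;
  manifold_second_countable : @second_countable carrier ;
  chart : Type ;
  dom : chart -> set carrier ;
  coord : chart -> carrier -> 'rV[R]_n ;
  coordV : chart -> 'rV[R]_n -> carrier ;
  dom_open : forall i, open (dom i) ;
  dom_cover : forall x, exists i, dom i x ;
  coordK : forall i x, dom i x -> coordV i (coord i x) = x ;
  coord_continuous : forall i x, dom i x -> {for x, continuous (coord i)} ;
  coord_open : forall i (U : set carrier), open U -> U `<=` dom i ->
    exists2 O : set 'rV[R]_n, open O & coord i @` U = O `&` halfspace ;
  transition_smooth : forall i j,
    smooth_on (coord i @` (dom i `&` dom j)) (coord j \o coordV i)
}.

Arguments dom {R n m} i _.
Arguments coord {R n m} i _.
Arguments coordV {R n m} i _.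

Section Cotangent.
Context {R : realType} {n : nat} {M : manifold R n}.
Implicit Types (i j : chart M) (x y : M).

Definition overlap i j : set 'rV[R]_n := coord i @` (dom i `&` dom j).

Definition transition i j : 'rV[R]_n -> 'rV[R]_n := coord j \o coordV i.

(* A covector at a point of M, given by its components in all the charts around
   this point, which are such that the pairing with tangent vectors does not
   depend on the chart. Its components in the other charts are set to 0 so that
   equal covectors are equal terms. *)
Record cotangent := Cotangent {
  base : M ;
  comp : chart M -> 'rV[R]_n ;
  comp_out : forall i, ~ dom i base -> comp i = 0 ;
  comp_compat : forall i j, dom i base -> dom j base ->
    exists2 L : {linear 'rV[R]_n -> 'rV[R]_n},
      diff_on (overlap i j) (transition i j) (coord i base) L &
      forall v, L v *m (comp j)^T = v *m (comp i)^T
}.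

HB.instance Definition _ := gen_eqMixin cotangent.
HB.instance Definition _ := gen_choiceMixin cotangent.

Implicit Types p q : cotangent.

Lemma cotangent_eq p q : base p = base q -> comp p = comp q -> p = q.
Proof.
case: p q => [x f fo fc] [y g go gc] /= xy fg; subst y g.
by congr Cotangent; exact: Prop_irrelevance.
Qed.

Definition nonzero p : Prop := exists i, comp p i != 0.

Lemma transition_diff i j x : dom i x -> dom j x ->
  exists L : {linear 'rV[R]_n -> 'rV[R]_n},
    diff_on (overlap i j) (transition i j) (coord i x) L.
Proof.
move=> ix jx; apply: smooth_on_diff; first exact: transition_smooth.
by exists x.
Qed.

Fact cscale_out (a : R) p i : ~ dom i (base p) -> a *: comp p i = 0.
Proof. by move=> /comp_out ->; rewrite scaler0. Qed.

Fact cscale_compat (a : R) p i j : dom i (base p) -> dom j (base p) ->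
  exists2 L : {linear 'rV[R]_n -> 'rV[R]_n},
    diff_on (overlap i j) (transition i j) (coord i (base p)) L &
    forall v, L v *m (a *: comp p j)^T = v *m (a *: comp p i)^T.
Proof.
move=> ip jp; have [L dL LE] := comp_compat ip jp; exists L => // v.
by rewrite !linearZ /= LE.
Qed.

Definition cscale (a : R) p : cotangent :=
  Cotangent (cscale_out a (p := p)) (cscale_compat a (p := p)).

Fact czero_compat x i j : dom i x -> dom j x ->
  exists2 L : {linear 'rV[R]_n -> 'rV[R]_n},
    diff_on (overlap i j) (transition i j) (coord i x) L &
    forall v, L v *m (0 : 'rV[R]_n)^T = v *m (0 : 'rV[R]_n)^T.
Proof.
by move=> ix jx; have [L dL] := transition_diff ix jx; exists L => // v;
  rewrite !trmx0 !mulmx0.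
Qed.

Definition czero x : cotangent :=
  @Cotangent x (fun=> 0) (fun _ _ => erefl) (@czero_compat x).

(* The covector at x with components eta in the chart i, for x in dom i; see
   covecP for its existence and covec_unique for its uniqueness. *)
Definition covec i x (eta : 'rV[R]_n) : cotangent :=
  xget (czero x) [set p | base p = x /\ comp p i = eta].

Lemma transition_diff_unique i j x (L1 L2 : 'rV[R]_n -> 'rV[R]_n) :
  dom i x -> dom j x ->
  diff_on (overlap i j) (transition i j) (coord i x) L1 ->
  diff_on (overlap i j) (transition i j) (coord i x) L2 ->
  L1 = L2.
Proof.
move=> ix jx.
have oU : open (dom i `&` dom j) by apply: openI; exact: dom_open.
have [|O oO OE] := coord_open (i := i) oU; first by move=> y [].
by rewrite /overlap OE; apply: diff_on_unique => //; rewrite -OE; exists x.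
Qed.

Lemma transition_diff_comp i j k x (L1 L2 L3 : 'rV[R]_n -> 'rV[R]_n) :
  dom i x -> dom j x -> dom k x ->
  diff_on (overlap i j) (transition i j) (coord i x) L1 ->
  diff_on (overlap j k) (transition j k) (coord j x) L2 ->
  diff_on (overlap i k) (transition i k) (coord i x) L3 ->
  L3 = L2 \o L1.
Proof.
move=> ix jx kx dL1 dL2 dL3.
pose U := dom i `&` dom j `&` dom k.
have oU : open U by do 2?[apply: openI]; exact: dom_open.
have [|O oO UE] := coord_open (i := i) oU; first by move=> y [[]].
have OH (y : 'rV[R]_n) : (O `&` halfspace) y <-> exists2 z, U z & coord i z = y.
  by rewrite -UE; split.
have Ox : (O `&` halfspace) (coord i x) by apply/OH; exists x.
apply: (diff_on_unique (f := transition i k) oO Ox).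
  by apply: diff_onW dL3 => // _ /OH[z [[iz jz] kz] <-]; exists z.
have [g1 [dg1 e1 L1E]] := dL1; have [g2 [dg2 e2 L2E]] := dL2.
have ij z : dom i z -> transition i j (coord i z) = coord j z.
  by move=> iz; rewrite /transition /= coordK.
have jk z : dom j z -> transition j k (coord j z) = coord k z.
  by move=> jz; rewrite /transition /= coordK.
have g1x : g1 (coord i x) = coord j x.
  move: e1; rewrite near_withinE => /nbhs_singleton <-; first exact: ij.
  by exists x.
rewrite -g1x in dg2 L2E; exists (g2 \o g1); split.
- exact: differentiable_comp dg1 dg2.
- rewrite !near_withinE in e1 e2 *.
  have cg1 : g1 y @[y --> coord i x] --> coord j x.
    by rewrite -g1x; exact: differentiable_continuous.
  have {}e2 := cg1 _ e2.
  near=> y => /OH[z [[iz jz] kz] yE].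
  have g1y : g1 y = coord j z.
    have /(_ _) <- : overlap i j y -> transition i j y = g1 y by near: y.
      by rewrite -yE ij.
    by exists z.
  have : overlap j k (g1 y) -> transition j k (g1 y) = g2 (g1 y) by near: y.
  rewrite /= g1y => <-; last by exists z.
  by rewrite -yE jk // /transition /= coordK.
- by have E := diff_comp dg1 dg2; rewrite L1E L2E; exact: esym E.
Unshelve. all: by end_near. Qed.

Lemma covec_unique i p q :
  dom i (base p) -> base q = base p -> comp q i = comp p i -> q = p.
Proof.
move=> ip pq cpq; apply: cotangent_eq => //; apply/funext => j.
have [jp|jp] := pselect (dom j (base p)); last by rewrite !comp_out ?pq.
have [L dL LE] := comp_compat jp ip.
have [||K dK KE] := @comp_compat q j i; rewrite ?pq //.
rewrite pq in dK; have LK := transition_diff_unique jp ip dL dK.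
apply: trmx_inj; apply/row_matrixP => k; rewrite !rowE.
by rewrite -KE -LE LK cpq.
Qed.

Lemma covecP i x eta : dom i x ->
  base (covec i x eta) = x /\ comp (covec i x eta) i = eta.
Proof.
move=> ix; rewrite /covec; case: xgetP => [p _ [-> ->] //|none].
have /choice[L dL] : forall j, exists L : {linear 'rV[R]_n -> 'rV[R]_n},
    dom j x -> diff_on (overlap j i) (transition j i) (coord j x) L.
  move=> j; have [jx|jx] := pselect (dom j x); last by exists idfun.
  by have [L dL] := transition_diff jx ix; exists L.
pose f j : 'rV[R]_n :=
  if pselect (dom j x) then \row_k (L j (delta_mx 0 k) *m eta^T) 0 0 else 0.
have fE j v : dom j x -> v *m (f j)^T = L j v *m eta^T.
  move=> jx; rewrite /f; case: pselect => //= ?.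
  rewrite {2}[v]row_sum_delta linear_sum /= mulmx_suml.
  apply/rowP => a; rewrite ord1 mxE summxE; apply: eq_bigr => k _.
  by rewrite linearZ /= -scalemxAl !mxE.
have f_out j : ~ dom j x -> f j = 0 by rewrite /f; case: pselect.
have f_compat j k : dom j x -> dom k x ->
    exists2 K : {linear 'rV[R]_n -> 'rV[R]_n},
    diff_on (overlap j k) (transition j k) (coord j x) K &
    forall v, K v *m (f k)^T = v *m (f j)^T.
  move=> jx kx; have [K dK] := transition_diff jx kx; exists K => // v.
  by rewrite !fE // (transition_diff_comp jx kx ix dK (dL k kx) (dL j jx)).
exfalso; apply: (none (@Cotangent x f f_out f_compat)); split=> //=.
apply: trmx_inj; apply/row_matrixP => k; rewrite !rowE fE //.
suff -> : L i = idfun :> (_ -> _) by [].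
apply: (transition_diff_unique ix ix (dL i ix)).
have [did idE] := is_diff_id (coord i x); exists id; split=> //.
rewrite near_withinE; apply: nearW => _ [z [iz _] <-].
by rewrite /transition /= coordK.
Qed.

End Cotangent.

Arguments cotangent {R n} M.

Section Hamiltonian.
Context {R : realType} {n : nat} {M : manifold R n}.
Implicit Types (i j : chart M) (x y : M) (p q : cotangent M).
Implicit Types (h : cotangent M -> R) (c : R -> cotangent M).

Definition canonical_coord i p : 'rV[R]_n * 'rV[R]_n :=
  (coord i (base p), comp p i).

Definition canonical_dom i : set ('rV[R]_n * 'rV[R]_n) :=
  [set z | (coord i @` dom i) z.1 /\ z.2 != 0].

Definition local_expr h i (z : 'rV[R]_n * 'rV[R]_n) : R :=
  h (covec i (coordV i z.1) z.2).

Definition diff_at h i p (dh : 'rV[R]_n * 'rV[R]_n -> R) : Prop :=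
  diff_on (canonical_dom i) (local_expr h i) (canonical_coord i p) dh.

(* Functions on the cotangent bundle without its zero section are represented
   by total functions whose values on the zero section are irrelevant. *)
Definition hamiltonian h : Prop :=
  [/\ forall i, smooth_on (canonical_dom i) (local_expr h i),
      forall p, nonzero p -> 0 < h p,
      forall (a : R) p, 0 < a -> nonzero p -> h (cscale a p) = a ^+ 2 * h p &
      forall p, nonzero p -> h p = 2^-1 -> forall i dh, dom i (base p) ->
        diff_at h i p dh -> exists v, dh v != 0].

Definition smooth_family (eps : R) (H : R -> cotangent M -> R) : Prop :=
  forall i, smooth_on [set w : ('rV[R]_n * 'rV[R]_n) * R |
                        canonical_dom i w.1 /\ `|w.2| < eps]
                      (fun w => local_expr (H w.2) i w.1).

Definition smooth_map {V : normedModType R} (A : set V) (c : V -> cotangent M) :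
    Prop :=
  forall w, A w -> forall i, dom i (base (c w)) ->
    exists U : set V, [/\ open U, U w,
      forall w', (U `&` A) w' -> dom i (base (c w')) &
      smooth_on (U `&` A) (fun w' => canonical_coord i (c w'))].

(* Hamiltonian curves parameterized by [0, T]. The derivative dc 1 of the curve
   is one-sided at the ends of the interval. *)
Definition bicharacteristic h (T : R) c : Prop :=
  forall t, 0 <= t <= T -> nonzero (c t) /\
    forall i, dom i (base (c t)) ->
      (\forall t' \near within `[0, T] (nbhs t), dom i (base (c t'))) /\
      exists (dc : R -> 'rV[R]_n * 'rV[R]_n)
             (dh : 'rV[R]_n * 'rV[R]_n -> R),
      [/\ diff_on `[0, T] (fun t' => canonical_coord i (c t')) t dc,
          diff_at h i (c t) dh,
          forall k, (dc 1).1 0 k = dh (0, delta_mx 0 k) &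
          forall k, (dc 1).2 0 k = - dh (delta_mx 0 k, 0)].

(* |xi|_x *)
Definition hnorm h p : R := Num.sqrt (2 * h p).

(* y = exp_x xi, for p = (x, xi) in the domain of the time one flow *)
Definition is_exp h p y : Prop :=
  exists c, [/\ bicharacteristic h 1 c, c 0 = p & base (c 1) = y].

(* y = exp_x xi and exp_x is a local diffeomorphism near xi, where p = (x, xi):
   for some open neighborhoods V of xi in the fiber over x and W of y in M,
   exp_x, read as F in charts, is a smooth bijection with smooth inverse G from
   V onto W. Bicharacteristics may leave M through its boundary, so exp_x is only
   partially defined and V is intersected with its domain. *)
Definition not_conjugate h p y : Prop :=
  exists i j (V : set 'rV[R]_n) (W : set M) (F G : 'rV[R]_n -> 'rV[R]_n),
  let x := base p in
  let D := [set eta | V eta /\ exists y', is_exp h (covec i x eta) y'] in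
  [/\ [/\ dom i x, open V & V (comp p i)],
      [/\ W `<=` dom j, open W, W y & is_exp h p y],
      forall eta y', V eta -> is_exp h (covec i x eta) y' ->
        [/\ W y', coord j y' = F eta & G (F eta) = eta],
      forall y', W y' ->
        V (G (coord j y')) /\ is_exp h (covec i x (G (coord j y'))) y' &
      smooth_on D F /\ smooth_on (coord j @` W) G].

(* The unit bicharacteristic from x to y corresponding to the bicharacteristic
   parameterized by [0, 1] issued from p = (x, xi): the one which is issued from
   (x, xi / |xi|_x). *)
Definition unit_bicharacteristic h p y c : Prop :=
  let T := hnorm h p in
  [/\ bicharacteristic h T c,
      forall t, 0 <= t <= T -> h (c t) = 2^-1,
      c 0 = cscale T^-1 p &
      base (c T) = y].

End Hamiltonian.

(* H_s *)
Definition param_deriv {R : realType} {n : nat} {M : manifold R n}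
    (H : R -> cotangent M -> R) (p : cotangent M) (s : R) : R :=
  derive1 (fun s' => H s' p) s.

(* Main.v *)
From HB Require Import structures.
Require Import Defs.
From mathcomp Require Import all_boot all_order all_algebra.
From mathcomp Require Import all_classical all_reals all_analysis.
From mathcomp Require Import lra ring.
Import Order.TTheory GRing.Theory Num.Theory.
Import numFieldNormedType.Exports.
Local Open Scope classical_set_scope.
Local Open Scope ring_scope.

(** The statement is the first variation formula, read on the energy. Let E(s)
    be the value of [H s] along the curve [c s]; it does not depend on the time
    ([energy_conserved]) and is half of the squared travel time, so that the
    first claim is E'(0) = - int_0^1 H_s dt. Denote by x_s, xi_s the derivatives
    in s at s = 0 and by x_t, xi_t the derivatives in time. By the chain rule
    and Hamilton's equations,
      E' = xi_s . x_t - x_s . xi_t + H_s,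
    while homogeneity gives 2 E = xi . x_t ([euler_identity]), hence
      2 E' = xi_s . x_t + xi . x_ts.
    Subtracting and exchanging the two derivatives of x
    ([mixed_derivatives_commute]), the function xi . x_s of the time has
    derivative E' + H_s ([is_derive_boundary_term]). It vanishes at both ends,
    where x is fixed, and integrating over [0, 1] gives the first claim.

    This computation is local, whereas the integration is global: it is possible
    because xi . x_s pairs a covector with a tangent vector, so that its
    expressions in two charts agree ([momentum_variation_chart]). At points of
    the boundary of M derivatives are those of smooth extensions; they are
    determined by the values on the half-space ([canonical_dom_unique]).
    Derivatives in time are only taken inside the time interval: at its ends,
    continuity is enough for the mean value theorem and for the fundamental
    theorem of calculus.

    For the second claim, T = sqrt (2 E) gives T' = E' / T. The curve
    t |-> (x(t / T), xi(t / T) / T) is a unit bicharacteristic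
    ([rescaled_bicharacteristic]), and H_s is homogeneous of degree two like H,
    so that the integral of H_s along it is 1 / T times the former one. Every
    unit bicharacteristic issued from the same covector is this curve, by
    uniqueness for Hamilton's equations ([bicharacteristic_uniqueness]). *)

Set Implicit Arguments.
Unset Strict Implicit.
Unset Printing Implicit Defensive.

(** * Derivatives along curves *)

Section Calculus.
Context {R : realType}.

Lemma is_derive_chain {V W : normedModType R} (f : V -> W) (z : R -> V) t v :
  differentiable f (z t) -> is_derive t (1 : R) z v ->
  is_derive t (1 : R) (f \o z) ('d f (z t) v).
Proof.
move=> df [dz <-].
have dz' : differentiable z t by apply/derivable1_diffP.
split; first by apply/derivable1_diffP; exact: differentiable_comp.
rewrite deriveE; last exact: differentiable_comp.
by rewrite (diff_comp dz' df) /= -(deriveE _ dz').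
Qed.

Lemma is_derive_continuous {V : normedModType R} (z : R -> V) t v :
  is_derive t (1 : R) z v -> {for t, continuous z}.
Proof.
by move=> [dz _]; apply/differentiable_continuous/derivable1_diffP.
Qed.

Lemma is_derive_line {V : normedModType R} (v y : V) (a : R) :
  is_derive a 1 (fun a : R => a *: v + y) v.
Proof.
have dl : is_derive a (1 : R) ( *:%R^~ v) v.
  split; first by apply/derivable1_diffP; exact: ex_diff.
  rewrite deriveE; last exact: ex_diff.
  by rewrite diff_val scale1r.
rewrite -[v in is_derive _ _ _ v]addr0.
exact: is_deriveD dl (is_derive_cst y a 1).
Qed.

Lemma is_derive_along {V W : normedModType R} (f : V -> W) (v y : V) (a : R) :
  differentiable f (a *: v + y) ->
  is_derive a (1 : R) (fun a : R => f (a *: v + y)) ('D_v f (a *: v + y)).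
Proof.
move=> df; rewrite deriveE //.
exact: (@is_derive_chain _ _ f (fun a => a *: v + y) _ _ df (is_derive_line _ _ _)).
Qed.

Lemma derive_linear_comp {V W Z : normedModType R} (f : V -> W)
    (l : {linear W -> Z}) x v :
  continuous l -> differentiable f x -> 'D_v (l \o f) x = l ('D_v f x).
Proof.
move=> cl df; have dl : differentiable l (f x) by exact: linear_differentiable.
have dlf := differentiable_comp df dl.
rewrite (deriveE _ dlf) (deriveE _ df).
apply: etrans (congr1 (@^~ v) (diff_comp df dl)) _.
exact: (congr1 (@^~ _) (diff_lin (f x) cl)).
Qed.

Lemma is_derive_linear_comp {V W : normedModType R} (l : {linear V -> W})
    (z : R -> V) t v :
  continuous l -> is_derive t (1 : R) z v -> is_derive t (1 : R) (l \o z) (l v).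
Proof.
move=> cl dz; rewrite -[X in is_derive _ _ _ (X _)](diff_lin (z t) cl).
apply: is_derive_chain => //; exact: linear_differentiable.
Qed.

Lemma is_derive_pair {V W : normedModType R} (f : R -> V) (g : R -> W) t a b :
  is_derive t (1 : R) f a -> is_derive t (1 : R) g b ->
  is_derive t (1 : R) (fun u => (f u, g u)) (a, b).
Proof.
move=> [df <-] [dg <-].
have df' : differentiable f t by apply/derivable1_diffP.
have dg' : differentiable g t by apply/derivable1_diffP.
have dfg := differentiable_pair df' dg'.
split; first by apply/derivable1_diffP.
rewrite deriveE // !deriveE //.
exact: (congr1 (@^~ 1) (diff_pair df' dg')).
Qed.

Lemma is_derive_fst {V W : normedModType R} (f : R -> V * W) t v :
  is_derive t (1 : R) f v -> is_derive t (1 : R) (fun t => (f t).1) v.1.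
Proof.
move=> df; have cf : continuous (fst : V * W -> V) by move=> z; exact: cvg_fst.
exact: (@is_derive_linear_comp _ _ (fst : {linear (V * W)%type -> V}) f t v cf df).
Qed.

Lemma is_derive_slice1 {W : normedModType R} (f : R * R -> W) (s t : R) :
  differentiable f (s, t) ->
  is_derive s (1 : R) (fun s => f (s, t)) ('D_(1, 0) f (s, t)).
Proof.
move=> df; rewrite deriveE //.
apply: (@is_derive_chain _ _ f (fun s => (s, t))) => //.
by apply: is_derive_pair.
Qed.

Lemma is_derive_slice2 {W : normedModType R} (f : R * R -> W) (s t : R) :
  differentiable f (s, t) ->
  is_derive t (1 : R) (fun t => f (s, t)) ('D_(0, 1) f (s, t)).
Proof.
move=> df; rewrite deriveE //.
apply: (@is_derive_chain _ _ f (fun t => (s, t))) => //.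
by apply: is_derive_pair.
Qed.

Lemma diff_slice {V W : normedModType R} (h : V * R -> W) z v :
  differentiable h (z, 0) ->
  differentiable (fun z => h (z, 0)) z /\ 'd (fun z => h (z, 0)) z v = 'd h (z, 0) (v, 0).
Proof.
move=> dh; have di : is_diff z (fun y : V => (y, 0 : R)) (fun v => (v, 0)).
  exact: is_diff_pair.
have [di1 di2] := di; split; first exact: (differentiable_comp di1 dh).
apply: etrans (congr1 (@^~ v) (diff_comp di1 dh)) _.
by rewrite /= (congr1 (@^~ v) di2).
Qed.

Lemma is_derive_dot {n : nat} (x y : R -> 'I_n -> R) t x' y' :
  (forall k, is_derive t (1 : R) (fun t => x t k) (x' k)) ->
  (forall k, is_derive t (1 : R) (fun t => y t k) (y' k)) ->
  is_derive t (1 : R) (fun t => \sum_k x t k * y t k)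
    (\sum_k x' k * y t k + \sum_k x t k * y' k).
Proof.
move=> dx dy; rewrite -big_split /=.
have -> : (fun t => \sum_k x t k * y t k) = \sum_k (fun t => x t k * y t k).
  by apply/funext => u; rewrite fct_sumE.
apply: is_derive_sum => k; apply: is_derive_eq (is_deriveM (dx k) (dy k)) _.
by rewrite /GRing.scale /=; ring.
Qed.

Lemma cvg_slice1 (s t : R) : (u, t) @[u --> s] --> (s, t).
Proof.
apply: (@cvg_pair _ _ _ (nbhs s) (nbhs s) (nbhs t) _ _ _ id (fun=> t)).
  exact: cvg_id.
exact: cvg_cst.
Qed.

Lemma cvg_slice2 (s t : R) : (s, u) @[u --> t] --> (s, t).
Proof.
apply: (@cvg_pair _ _ _ (nbhs t) (nbhs s) (nbhs t) _ _ _ (fun=> s) id).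
  exact: cvg_cst.
exact: cvg_id.
Qed.

Lemma near_slice1 (s t : R) (P : set (R * R)) :
  (\forall w \near (s, t), P w) -> \forall u \near s, P (u, t).
Proof. by move=> nP; exact: (@cvg_slice1 s t _ nP). Qed.

Lemma near_slice2 (s t : R) (P : set (R * R)) :
  (\forall w \near (s, t), P w) -> \forall u \near t, P (s, u).
Proof. by move=> nP; exact: (@cvg_slice2 s t _ nP). Qed.

Lemma near_interior (A : set R) (t : R) (P : R -> Prop) :
  nbhs t A -> (\forall t' \near within A (nbhs t), P t') ->
  \forall t' \near t, P t'.
Proof.
rewrite near_withinE => nA; apply: filterS2 nA => t' At'; exact.
Qed.

Lemma nbhs_segment (a b t : R) : a < t < b -> nbhs t [set` `[a, b]].
Proof.
move=> tab; have N : nbhs t [set` `]a, b[] by apply: near_in_itvoo; rewrite in_itv.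
by apply: filterS N => u /=; rewrite !in_itv /= => /andP[/ltW -> /ltW ->].
Qed.

Lemma within_at_left (T s : R) : 0 < s <= T ->
  s^'- `=>` within `[0, T] (nbhs s).
Proof.
move=> /andP[s0 sT] P; rewrite /within /= => nP.
have n0 : \forall u \near s, 0 < u := lt_nbhsr s0.
rewrite /at_left /within /=.
near=> u => us; have /(_ _) : `[0, T]%classic u -> P u by near: u.
apply; rewrite /= in_itv /= (ltW (lt_le_trans us sT)) andbT ltW //.
by near: u.
Unshelve. all: by end_near. Qed.

Lemma within_continuous_near (A : set R) (f F : R -> R) t :
  A t -> (\forall u \near t, A u -> f u = F u) -> {for t, continuous F} ->
  f u @[u --> within A (nbhs t)] --> f t.
Proof.
move=> At fF cF; rewrite (nbhs_singleton fF At).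
apply: (@cvg_trans _ (F u @[u --> within A (nbhs t)])).
  by apply: near_eq_cvg; rewrite near_withinE; apply: filterS fF => u E Au; rewrite E.
exact: cvg_within_filter.
Qed.

Lemma within_continuous_scale (f : R -> R) (a : R) : 0 < a ->
  {within `[0, 1], continuous f} ->
  {within `[0, a^-1], continuous (fun t => f (a * t))}.
Proof.
move=> a0 /subspace_continuousP cf; apply/subspace_continuousP => t tA.
have sub u : `[0, a^-1]%classic u -> `[0, 1]%classic (a * u).
  rewrite /= !in_itv /= => /andP[u0 ua]; rewrite mulr_ge0 ?(ltW a0) //=.
  by rewrite -(divff (lt0r_neq0 a0)) ler_wpM2l // ltW.
have ca : a * u @[u --> t] --> a * t by apply: cvgM; [exact: cvg_cst|exact: cvg_id].
move=> P nP.
have near_f : \forall u \near a * t, `[0, 1]%classic u -> P (f u).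
  exact: (cf _ (sub _ tA) _ nP).
have near_a : \forall u \near t, `[0, 1]%classic (a * u) -> P (f (a * u)).
  exact: (ca _ near_f).
suff : \forall u \near within `[0, a^-1] (nbhs t), P (f (a * u)) by [].
rewrite near_withinE; apply: filterS near_a => u E /sub; exact: E.
Qed.

(** * Symmetry of second derivatives *)

(** Two applications of the mean value theorem, along u and then along v. The
    left-hand side is symmetric in u and v, which is why the mixed derivatives
    agree in the limit. *)
Lemma second_difference {V : normedModType R} (f : V -> R) (x u v : V) (h : R) :
  0 < h ->
  (forall a b, 0 <= a <= h -> 0 <= b <= h ->
    differentiable f (a *: u + (b *: v + x)) /\
    differentiable ('D_u f) (a *: u + (b *: v + x))) ->
  exists a b, [/\ 0 <= a <= h, 0 <= b <= h &
    f (h *: u + (h *: v + x)) - f (h *: u + x) - (f (h *: v + x) - f x) =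
      h ^+ 2 * 'D_v ('D_u f) (a *: u + (b *: v + x))].
Proof.
move=> h0 df.
pose phi a := f (a *: u + (h *: v + x)) - f (a *: u + x).
have hh : 0 <= h <= h by rewrite lexx ltW.
have h00 : 0 <= (0 : R) <= h by rewrite lexx ltW.
pose dphi a := 'D_u f (a *: u + (h *: v + x)) - 'D_u f (a *: u + x).
have phiE a : 0 <= a <= h -> is_derive a (1 : R) phi (dphi a).
  move=> ah; apply: is_deriveB; apply: is_derive_along.
    by have [] := df a h ah hh.
  by have [] := df a 0 ah h00; rewrite scale0r add0r.
have [||a ah Ea] := @MVT_segment R phi dphi 0 h (ltW h0).
- by move=> a /[!in_itv]/= /andP[a0 ah]; apply: phiE; rewrite !ltW.
- apply: derivable_within_continuous => a /[!in_itv]/= ah.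
  by have [] := phiE a ah.
rewrite in_itv/= in ah.
pose psi b := 'D_u f (b *: v + (a *: u + x)).
have sw b : b *: v + (a *: u + x) = a *: u + (b *: v + x) by rewrite addrCA.
pose dpsi b := 'D_v ('D_u f) (b *: v + (a *: u + x)).
have psiE b : 0 <= b <= h -> is_derive b (1 : R) psi (dpsi b).
  by move=> bh; apply: is_derive_along; rewrite sw; have [] := df a b ah bh.
have [||b bh Eb] := @MVT_segment R psi dpsi 0 h (ltW h0).
- by move=> b /[!in_itv]/= /andP[b0 bh]; apply: psiE; rewrite !ltW.
- apply: derivable_within_continuous => b /[!in_itv]/= bh.
  by have [] := psiE b bh.
rewrite in_itv/= in bh.
exists a, b; split => //.
move: Ea; rewrite /phi /dphi !scale0r !add0r !subr0 => ->.
by move: Eb; rewrite /psi /dpsi !sw scale0r add0r subr0 => ->; ring.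
Qed.

Lemma near_parallelogram {V : normedModType R} (x u v : V) (P : set V) :
  nbhs x P -> exists2 h : R, 0 < h & forall a b, 0 <= a <= h -> 0 <= b <= h ->
    P (a *: u + (b *: v + x)).
Proof.
move=> nP; pose l (q : R * R) := q.1 *: u + (q.2 *: v + x).
have cl : l q @[q --> ((0 : R), (0 : R))] --> x.
  rewrite [X in _ --> X](_ : x = 0 *: u + (0 *: v + x)); last by rewrite !scale0r !add0r.
  apply: cvgD; first by apply: cvgZr_tmp; exact: cvg_fst.
  by apply: cvgD; [apply: cvgZr_tmp; exact: cvg_snd | exact: cvg_cst].
have /nbhs_ballP[e /= e0 be] := cl _ nP.
exists (e / 2); first by rewrite divr_gt0.
move=> a b /andP[a0 ae] /andP[b0 be']; apply: (be (a, b)).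
split => /=; rewrite /ball/= sub0r normrN ger0_norm //; lra.
Qed.

(** Here p and q are the two mixed derivatives at the point under study, P and
    Q their values at the intermediate points of the two second differences. *)
Lemma close_of_second_differences (h e A B C D P Q p q : R) :
  0 < h -> A - B - (C - D) = h ^+ 2 * P -> A - C - (B - D) = h ^+ 2 * Q ->
  `|p - P| < e / 2 -> `|q - Q| < e / 2 -> q <= p + e.
Proof.
move=> h0 e1 e2; have h2 : h ^+ 2 != 0 by rewrite expf_neq0 // gt_eqF.
have -> : P = Q by apply: (mulfI h2); rewrite -e1 -e2; ring.
rewrite !ltr_distl => /andP[+ _] /andP[_ +]; clear; lra.
Qed.

Lemma mixed_derivatives_commute {V : normedModType R} (f : V -> R) (U : set V) x u v :
  open U -> U x -> Ck 2 U f -> 'D_u ('D_v f) x = 'D_v ('D_u f) x.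
Proof.
move=> oU Ux [df Cf]; apply/eqP; rewrite eq_le.
suff H u' v' : 'D_u' ('D_v' f) x <= 'D_v' ('D_u' f) x.
  by apply/andP; split; exact: H.
apply/ler_addgt0Pr => e e0.
have cD a b : {for x, continuous ('D_a ('D_b f))}.
  by have [_ /(_ a) C0] := Cf b; exact: C0.
have e2 : 0 < e / 2 by rewrite divr_gt0.
have := cD u' v' => /cvgrPdist_lt /(_ _ e2) N1.
have := cD v' u' => /cvgrPdist_lt /(_ _ e2) N2.
have [h h0 Hh] : exists2 h : R, 0 < h & forall a b, 0 <= a <= h -> 0 <= b <= h ->
    [/\ U (a *: u' + (b *: v' + x)),
     `|'D_u' ('D_v' f) x - 'D_u' ('D_v' f) (a *: u' + (b *: v' + x))| < e / 2 &
     `|'D_v' ('D_u' f) x - 'D_v' ('D_u' f) (a *: u' + (b *: v' + x))| < e / 2].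
  apply: (@near_parallelogram V x u' v' [set z | [/\ U z,
     `|'D_u' ('D_v' f) x - 'D_u' ('D_v' f) z| < e / 2 &
     `|'D_v' ('D_u' f) x - 'D_v' ('D_u' f) z| < e / 2]]).
  have N0 : nbhs x U by exact: open_nbhs_nbhs.
  apply: filterS (filterI (filterI N0 N1) N2) => z [[Uz d1] d2]; exact (And3 Uz d1 d2).
have [a [b [ah bh E1]]] : exists a b, [/\ 0 <= a <= h, 0 <= b <= h &
    f (h *: u' + (h *: v' + x)) - f (h *: u' + x) - (f (h *: v' + x) - f x) =
      h ^+ 2 * 'D_v' ('D_u' f) (a *: u' + (b *: v' + x))].
  apply: second_difference => // a b ah bh; have [Uz _ _] := Hh _ _ ah bh.
  by split; [exact: df|have [+ _] := Cf u'; exact].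
have [a' [b' [ah' bh' E2]]] : exists a b, [/\ 0 <= a <= h, 0 <= b <= h &
    f (h *: v' + (h *: u' + x)) - f (h *: v' + x) - (f (h *: u' + x) - f x) =
      h ^+ 2 * 'D_u' ('D_v' f) (a *: v' + (b *: u' + x))].
  apply: second_difference => // b' a' bh' ah'; have [Uz _ _] := Hh _ _ ah' bh'.
  by rewrite addrCA; split; [exact: df|have [+ _] := Cf v'; exact].
have [_ _ d1] := Hh _ _ ah bh; have [_ + _] := Hh _ _ bh' ah'.
rewrite [b' *: u' + _]addrCA => d2.
move: E2; rewrite [h *: v' + (h *: u' + x)]addrCA => E2.
exact: (close_of_second_differences h0 E1 E2 d1 d2).
Qed.

Lemma near_eq_differentiable {V W : normedModType R} (f g : V -> W) x :
  (\forall y \near x, f y = g y) -> differentiable f x -> differentiable g x.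
Proof.
move=> fg df; pose k : V -> W := g - f.
have k0 : \forall y \near x, k y = 0.
  by apply: filterS fg => y fgy; rewrite /k !fctE fgy subrr.
have kx : k x = 0 by exact: (nbhs_singleton k0).
have ko : k \o shift x = cst (k x) + (\0 : {linear V -> W}) +o_ (0 : V) id.
  apply/eqaddoP => e e0; rewrite kx.
  have cs : y + x @[y --> (0 : V)] --> x.
    rewrite -[X in _ --> X]add0r; apply: cvgD; [exact: cvg_id|exact: cvg_cst].
  have near_k : \forall y \near (0 : V), k (y + x) = 0 by exact: (cs _ k0).
  apply: filterS near_k => y ky.
  rewrite !fctE /= ky !addr0 subrr normr0; apply: mulr_ge0 => //; exact: ltW.
have c0 : continuous (\0 : {linear V -> W}) by exact: cst_continuous.
have dk0 := diff_unique c0 ko.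
have dk : differentiable k x by apply/diff_locallyP; rewrite dk0.
have -> : g = f + k by rewrite /k addrC subrK.
exact: differentiableD.
Qed.

(** The derivatives of a composite are only known on U, so the class C^k on U
    has to depend on the values on U alone. *)
Lemma Ck_ext {V W : normedModType R} k (U : set V) (f g : V -> W) :
  open U -> (forall x, U x -> f x = g x) -> Ck k U f -> Ck k U g.
Proof.
move=> oU; elim: k f g => [|k IH] f g fg /=.
  move=> cf x Ux; have := cf x Ux; rewrite /prop_for /continuous_at fg // => cfx.
  apply: cvg_trans cfx; apply: near_eq_cvg.
  have nU : nbhs x U by exact: open_nbhs_nbhs.
  by apply: filterS nU => y /fg ->.
have near_fg x : U x -> \forall y \near x, f y = g y.
  move=> Ux; have nU : nbhs x U by exact: open_nbhs_nbhs.
  by apply: filterS nU => y /fg ->.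
move=> [df Cf]; split=> [x Ux|v].
  exact: near_eq_differentiable (near_fg x Ux) (df x Ux).
apply: IH (Cf v) => x Ux; apply: near_eq_derive; exact: near_fg.
Qed.

Lemma Ck_linear_comp {V W Z : normedModType R} k (U : set V) (f : V -> W)
    (l : {linear W -> Z}) :
  open U -> continuous l -> Ck k U f -> Ck k U (l \o f).
Proof.
move=> oU cl; elim: k f => [|k IH] f /=.
  by move=> cf x Ux; apply: continuous_comp; [exact: cf|exact: cl].
have dl x : differentiable l x by exact: linear_differentiable.
move=> [df Cf]; split=> [x Ux|v].
  by apply: differentiable_comp; [exact: df|exact: dl].
apply: (Ck_ext oU _ (IH _ (Cf v))) => x Ux /=.
have dlf : differentiable (l \o f) x.
  by apply: differentiable_comp; [exact: df|exact: dl].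
rewrite (deriveE _ dlf) (deriveE _ (df x Ux)).
have E := congr1 (@^~ v) (diff_comp (df x Ux) (dl (f x))).
apply: etrans (esym E).
by apply: etrans (esym (congr1 (@^~ _) (diff_lin (f x) cl))).
Qed.

(** * Differentials on sets with boundary *)

Lemma diff_on_cvg {V W : normedModType R} (A : set V) (f : V -> W) x L :
  A x -> diff_on A f x L -> f y @[y --> within A (nbhs x)] --> f x.
Proof.
move=> Ax [g [dg fg _]].
have fx : f x = g x.
  by move: fg; rewrite near_withinE => /nbhs_singleton; exact.
rewrite fx; apply: (@cvg_trans _ (g y @[y --> within A (nbhs x)])).
  by apply: near_eq_cvg; apply: filterS fg => y ->.
by apply: cvg_within_filter; exact: differentiable_continuous dg.
Qed.

(** Along a direction that points into A, the one-sided difference quotients of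
    two extensions of f only involve values of f. *)
Lemma diff_on_dir {V W : normedModType R} (A : set V) (f : V -> W) (x v : V) L1 L2 :
  A x -> (\forall h \near 0^'+, A (h *: v + x)) ->
  diff_on A f x L1 -> diff_on A f x L2 -> L1 v = L2 v.
Proof.
move=> Ax Av [g1 [dg1 e1 ->]] [g2 [dg2 e2 ->]].
apply/eqP; rewrite -subr_eq0; apply/eqP.
pose g := g1 - g2.
have dg : differentiable g x by exact: differentiableB.
have -> : 'd g1 x v - 'd g2 x v = 'D_v g x.
  by rewrite deriveB ?deriveE //; apply: diff_derivable.
have gx0 : \forall y \near nbhs x, A y -> g y = 0.
  rewrite !near_withinE in e1 e2; apply: filterS2 e1 e2 => y h1 h2 Ay.
  by rewrite /g !fctE -h1 // -h2 // subrr.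
have cv0 : (h^-1 *: ((g \o shift x) (h *: v) - g x)) @[h --> 0^'+] --> 'D_v g x.
  apply: cvg_dnbhs_at_right.
  exact: (@diff_derivable _ _ _ g x v dg).
apply/esym; apply: (cvg_unique _ _ cv0) => //.
apply: cvg_near_cst.
have cy : (h *: v + x) @[h --> 0^'+] --> x.
  rewrite -[X in _ --> X]add0r -(scale0r v).
  apply: cvgD; last exact: cvg_cst.
  by apply: cvgZr_tmp; apply: cvg_at_right_filter; exact: cvg_id.
have g0 : g x = 0 by apply: (nbhs_singleton gx0).
near=> h; rewrite /= g0 subr0.
have -> : g (h *: v + x) = 0; last by rewrite scaler0.
have Ah : A (h *: v + x) by near: h.
by move: Ah; near: h; exact: (cy _ gx0).
Unshelve. all: by end_near. Qed.

Lemma Ck_diff_on {V W : normedModType R} (A U : set V) (f g : V -> W) x :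
  open U -> U x -> Ck 1 U g -> (forall y, A y -> U y -> f y = g y) ->
  diff_on A f x ('d g x).
Proof.
move=> oU Ux [dg _] fg; exists g; split=> //; first exact: dg.
rewrite near_withinE.
have N : nbhs x U by exact: open_nbhs_nbhs.
by apply: filterS N => y Uy Ay; exact: fg.
Qed.

Lemma ball_segment {V : normedModType R} (x y z : V) e (a : R) :
  0 <= a <= 1 -> ball x e y -> ball x e z -> ball x e (a *: (y - z) + z).
Proof.
move=> /andP[a0 a1]; rewrite -ball_normE /ball_ /= => xy xz.
have -> : x - (a *: (y - z) + z) = a *: (x - y) + (1 - a) *: (x - z).
  rewrite !scalerBr scalerBl !scale1r scalerBl scale1r opprB.
  rewrite [RHS]addrCA [RHS]addrA subrKA opprD opprB [a *: z - _]addrC.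
  by rewrite -[in LHS]addrA [LHS]addrA.
apply: le_lt_trans (ler_normD _ _) _.
rewrite !normrZ (ger0_norm a0) ger0_norm ?subr_ge0 //.
move: a0; rewrite le_eqVlt => /predU1P[<-|a0].
  by rewrite mul0r add0r subr0 mul1r.
have -> : e = a * e + (1 - a) * e by ring.
by apply: ltr_leD; [rewrite ltr_pM2l|rewrite ler_wpM2l ?subr_ge0 // ltW].
Qed.

End Calculus.

(** * Phase space *)

Section PhaseSpace.
Context {R : realType} {n : nat}.
Local Notation phase := ('rV[R]_n * 'rV[R]_n)%type.

(** Positions and momenta are indexed by a single type, [true] standing for the
    positions, so that the 2n scalar equations of Hamilton are treated alike. *)
Definition phase_coord (p : bool * 'I_n) (z : phase) : R :=
  (if p.1 then z.1 else z.2) 0 p.2.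

Definition phase_delta (p : bool * 'I_n) : phase :=
  if p.1 then (delta_mx 0 p.2, 0) else (0, delta_mx 0 p.2).

Fact phase_coord_is_linear p : linear (phase_coord p).
Proof. by move=> a u v; rewrite /phase_coord; case: p.1; rewrite /= !mxE. Qed.

HB.instance Definition _ p := GRing.isLinear.Build R phase R _ _
  (phase_coord_is_linear p).

Lemma phase_coord_continuous p : continuous (phase_coord p).
Proof.
move=> z; rewrite /continuous_at /phase_coord; case: p => [[] k] /=.
  apply: (cvg_comp (fun z : phase => z.1) (fun x : 'rV[R]_n => x 0 k)).
    exact: cvg_fst.
  exact: coord_continuous.
apply: (cvg_comp (fun z : phase => z.2) (fun x : 'rV[R]_n => x 0 k)).
  exact: cvg_snd.
exact: coord_continuous.
Qed.

Lemma phase_sum_delta (z : phase) :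
  z = \sum_p phase_coord p z *: phase_delta p.
Proof.
rewrite -(pair_bigA _ (fun b k => phase_coord (b, k) z *: phase_delta (b, k))) /=.
rewrite big_bool /=; case: z => v w.
have pairE (b : bool) : \sum_k phase_coord (b, k) (v, w) *: phase_delta (b, k) =
    (\sum_k (if b then v 0 k else 0) *: delta_mx 0 k,
     \sum_k (if b then 0 else w 0 k) *: delta_mx 0 k).
  elim/big_rec3: _ => // k y1 y2 y3 _ ->; congr pair; rewrite /phase_coord /=.
    by case: b => /=; rewrite ?scaler0 ?scale0r.
  by case: b => /=; rewrite ?scaler0 ?scale0r.
rewrite !pairE /= [in LHS](row_sum_delta v) [in LHS](row_sum_delta w).
have z0 : \sum_(k < n) (0 : R) *: delta_mx 0 k = 0 :> 'rV[R]_n.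
  by apply: big1 => k _; rewrite scale0r.
by congr pair; rewrite /= z0 ?addr0 ?add0r.
Qed.

Lemma phase_ext (z w : phase) :
  (forall r, phase_coord r z = phase_coord r w) -> z = w.
Proof.
move=> zw; rewrite (phase_sum_delta z) (phase_sum_delta w).
by apply: eq_bigr => r _; rewrite zw.
Qed.

Lemma linear_phaseE (L : {linear phase -> R}) z :
  L z = \sum_p phase_coord p z * L (phase_delta p).
Proof.
rewrite {1}(phase_sum_delta z) linear_sum; apply: eq_bigr => p _.
by rewrite linearZ.
Qed.

Lemma phase_coord_norm p z : `|phase_coord p z| <= `|z|.
Proof.
have H (x : 'rV[R]_n) k : `|x 0 k| <= `|x|.
  by rewrite /Num.Def.normr /= mx_normrE; apply: le_trans (le_bigmax _ _ (0, k)).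
rewrite /phase_coord prod_normE le_max; case: p => [[] k] /=.
  by rewrite H.
by rewrite H orbT.
Qed.

Lemma phase_norm_le (z : phase) B : 0 <= B ->
  (forall p, `|phase_coord p z| <= B) -> `|z| <= B.
Proof.
move=> B0 H; rewrite prod_normE ge_max; apply/andP; split.
  rewrite /Num.Def.normr /= mx_normrE; apply: bigmax_le => // -[i k] _ /=.
  by have := H (true, k); rewrite /phase_coord /= ord1.
rewrite /Num.Def.normr /= mx_normrE; apply: bigmax_le => // -[i k] _ /=.
by have := H (false, k); rewrite /phase_coord /= ord1.
Qed.

Lemma mixed_phase_derivatives_commute {V : normedModType R}
    (g : V -> phase) (U : set V) x u v :
  open U -> U x -> Ck 2 U g -> 'D_u ('D_v g) x = 'D_v ('D_u g) x.
Proof.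
move=> oU Ux Cg; have [dg C1] := Cg.
have H r a b : phase_coord r ('D_a ('D_b g) x) = 'D_a ('D_b (phase_coord r \o g)) x.
  have cr := @phase_coord_continuous r.
  have [dbg _] := C1 b.
  rewrite -(derive_linear_comp _ cr (dbg x Ux)); apply: near_eq_derive.
  have nU : nbhs x U by exact: open_nbhs_nbhs.
  by apply: filterS nU => y Uy; rewrite (derive_linear_comp _ cr (dg y Uy)).
apply: phase_ext => r.
apply: etrans (H r u v) _; apply: etrans _ (esym (H r v u)).
apply: (mixed_derivatives_commute _ _ oU Ux).
exact: (Ck_linear_comp oU (@phase_coord_continuous r) Cg).
Qed.

(** By the mean value theorem, an increment of f is bounded by its derivatives
    along the finitely many basis vectors, which are bounded near x. *)
Lemma locally_lipschitz (f : phase -> R) (U : set phase) x :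
  open U -> U x -> Ck 1 U f ->
  exists K e : R, [/\ 0 <= K, 0 < e & forall y z, ball x e y -> ball x e z ->
    `|f y - f z| <= K * `|y - z|].
Proof.
move=> oU Ux [df C0].
pose m p := `|'D_(phase_delta p) f x| + 1.
have N : \forall y \near x, U y /\ forall p, `|'D_(phase_delta p) f y| <= m p.
  apply: filterI; first exact: open_nbhs_nbhs.
  apply: (@filter_forall _ _ (fun p y => `|'D_(phase_delta p) f y| <= m p)
    (nbhs x) _) => p.
  have /cvgrPdist_lt /(_ 1 ltr01) := C0 (phase_delta p) x Ux.
  apply: filterS => y H; rewrite /m -lerBlDl; apply: le_trans (ltW H).
  by rewrite distrC; exact: lerB_dist.
have [e /= e0 be] := (nbhs_ballP _ _).1 N.
exists (\sum_p m p), e; split => //.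
  by apply: sumr_ge0 => p _; rewrite addr_ge0.
move=> y z by_ bz.
pose phi (a : R) := f (a *: (y - z) + z).
pose dphi (a : R) : R := 'D_(y - z) f (a *: (y - z) + z).
have phiE (a : R) : 0 <= a <= 1 -> is_derive a (1 : R) phi (dphi a).
  move=> a01; apply: is_derive_along; apply: df.
  by have [] := be _ (ball_segment a01 by_ bz).
have [||a ah Ea] := @MVT_segment R phi dphi 0 1 ler01.
- by move=> a /[!in_itv]/= /andP[a0 ah]; apply: phiE; rewrite !ltW.
- apply: derivable_within_continuous => a /[!in_itv]/= ah.
  by have [] := phiE a ah.
rewrite in_itv/= in ah.
have [Uc mc] := be _ (ball_segment ah by_ bz).
move: Ea; rewrite /phi scale1r scale0r add0r subrK => ->.
rewrite subr0 mulr1 /dphi deriveE; last exact: df.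
rewrite linear_phaseE mulr_suml; apply: le_trans (ler_norm_sum _ _ _) _.
apply: ler_sum => p _; rewrite normrM mulrC; apply: ler_pM => //.
  by rewrite -deriveE; [exact: mc|exact: df].
exact: phase_coord_norm.
Qed.

(** On an interval shorter than 1 / K the largest distance between two solutions
    is, by the mean value theorem applied to each coordinate at the time where it
    is reached, at most K (b - a) < 1 times itself, hence it is zero. *)
Lemma forward_uniqueness (z1 z2 : R -> phase) (B : set phase)
    (X : bool * 'I_n -> phase -> R) (K a b : R) :
  0 <= K -> a <= b -> K * (b - a) < 1 ->
  (forall p y z, B y -> B z -> `|X p y - X p z| <= K * `|y - z|) ->
  (forall t, a <= t <= b -> B (z1 t) /\ B (z2 t)) ->
  {within `[a, b], continuous z1} -> {within `[a, b], continuous z2} ->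
  (forall p t, a < t < b -> is_derive t (1 : R) (phase_coord p \o z1) (X p (z1 t))) ->
  (forall p t, a < t < b -> is_derive t (1 : R) (phase_coord p \o z2) (X p (z2 t))) ->
  z1 a = z2 a -> forall t, a <= t <= b -> z1 t = z2 t.
Proof.
move=> K0 ab Kab lX Bz c1 c2 d1 d2 za.
have cd : {within `[a, b], continuous (fun t => z1 t - z2 t)}.
  by move=> t; apply: cvgB; [exact: c1|exact: c2].
have cn : {within `[a, b], continuous (fun t => `|z1 t - z2 t|)}.
  by move=> t; apply: cvg_norm; exact: cd.
have [m mab maxm] := EVT_max ab cn.
have mE := mab; rewrite in_itv /= in mE; have /andP[am mb] := mE.
set mu := `|z1 m - z2 m| in maxm.
have muK : mu <= K * mu * (b - a).
  apply: phase_norm_le.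
    apply: mulr_ge0; last by rewrite subr_ge0.
    by apply: mulr_ge0 => //; exact: normr_ge0.
  move=> p.
  pose g t := phase_coord p (z1 t) - phase_coord p (z2 t).
  pose dg t := X p (z1 t) - X p (z2 t).
  have gE : g m - g a = phase_coord p (z1 m - z2 m).
    by rewrite /g za subrr subr0 linearB.
  have ma : `]a, m[ `<=` `]a, b[.
    by apply: subset_itvl; rewrite bnd_simp.
  have [||c cam E] := @MVT_segment R g dg a m am.
  - move=> t tam; have := ma t tam; rewrite /= in_itv /= => tab.
    by apply: is_deriveB; [exact: d1|exact: d2].
  - have sub : `[a, m] `<=` `[a, b] by apply: subset_itvl; rewrite bnd_simp.
    apply: (continuous_subspaceW sub).
    have -> : g = phase_coord p \o (fun t => z1 t - z2 t).
      by apply/funext => u /=; rewrite linearB.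
    apply/subspace_continuousP => t tab.
    have /subspace_continuousP/(_ t tab) ct := cd.
    by apply: (cvg_comp _ _ ct); exact: phase_coord_continuous.
  have /andP[ac cm] : a <= c <= m by move: cam; rewrite in_itv.
  have cab : a <= c <= b by rewrite ac (le_trans cm mb).
  rewrite -gE E normrM; have [B1 B2] := Bz c cab.
  have lX1 := lX p _ _ B1 B2.
  apply: ler_pM => //; last first.
    by rewrite ger0_norm ?subr_ge0 // lerB.
  apply: le_trans lX1 _; rewrite ler_wpM2l //.
  by apply: maxm; rewrite in_itv.
have mu0 : mu = 0.
  apply/eqP; rewrite eq_le normr_ge0 andbT leNgt; apply/negP => mup.
  by move: muK; rewrite mulrAC -{1}[mu]mul1r ler_pM2r // leNgt Kab.
move=> t tab; apply/eqP; rewrite -subr_eq0 -normr_eq0 eq_le normr_ge0 andbT.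
by rewrite -mu0; apply: maxm; rewrite in_itv.
Qed.

Definition hamilton_rhs (dh : phase -> R) (r : bool * 'I_n) : R :=
  if r.1 then dh (0, delta_mx 0 r.2) else - dh (delta_mx 0 r.2, 0).

(** Hamilton's equations say that the differential of the Hamiltonian is the
    symplectic pairing with the velocity z'. For w the velocity itself this gives
    the conservation of energy, for w the derivative of the curve with respect to
    a parameter it gives the first variation. *)
Lemma differential_pairing (dh : {linear phase -> R}) (z' w : phase) :
  (forall r, phase_coord r z' = hamilton_rhs dh r) ->
  dh w = \sum_k (w.2 0 k * z'.1 0 k - w.1 0 k * z'.2 0 k).
Proof.
move=> hz; rewrite linear_phaseE.
rewrite -(pair_bigA _ (fun b k => phase_coord (b, k) w * dh (phase_delta (b, k)))) /=.
rewrite big_bool /= addrC -big_split /=; apply: eq_bigr => k _.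
have := hz (true, k); have := hz (false, k).
rewrite /hamilton_rhs /phase_coord /phase_delta /= => -> ->.
by rewrite mulrN opprK.
Qed.

Lemma hamilton_rhs_lipschitz (g : phase -> R) (U : set phase) z0 :
  open U -> U z0 -> Ck 2 U g ->
  exists K (B : set phase), [/\ 0 <= K, nbhs z0 B, B `<=` U &
    forall r y z, B y -> B z ->
      `|hamilton_rhs ('d g y) r - hamilton_rhs ('d g z) r| <= K * `|y - z|].
Proof.
move=> oU Uz [dg C1].
pose v (r : bool * 'I_n) : phase := phase_delta (~~ r.1, r.2).
have /choice[K /choice[e Ke]] : forall r : bool * 'I_n, exists K e : R,
    [/\ 0 <= K, 0 < e &
    forall y z, ball z0 e y -> ball z0 e z ->
    `|'D_(v r) g y - 'D_(v r) g z| <= K * `|y - z|].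
  by move=> r; exact: (locally_lipschitz oU Uz (C1 (v r))).
exists (\sum_r K r), [set z | U z /\ forall r, ball z0 (e r) z]; split.
- by apply: sumr_ge0 => r _; have [] := Ke r.
- apply: filterI; first exact: open_nbhs_nbhs.
  apply: (@filter_forall _ _ (fun r z => ball z0 (e r) z) (nbhs z0) _) => r.
  by apply: nbhsx_ballx; have [] := Ke r.
- by move=> z [].
move=> r y z [Uy By] [Uz' Bz]; have [K0 e0 lip] := Ke r.
apply: (@le_trans _ _ (K r * `|y - z|)); last first.
  rewrite ler_wpM2r //; rewrite (bigD1 r) //= lerDl.
  by apply: sumr_ge0 => r' _; have [] := Ke r'.
apply: le_trans (lip y z (By r) (Bz r)).
rewrite !deriveE; [|exact: dg|exact: dg].
by rewrite /hamilton_rhs /v /phase_delta; case: r {K0 e0 lip} => [[] k] //=;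
  rewrite -opprD normrN.
Qed.

Definition fiber_scale (a : R) (z : phase) : phase := (z.1, a *: z.2).

Fact fiber_scale_is_linear a : linear (fiber_scale a).
Proof.
move=> k [u1 u2] [v1 v2]; rewrite /fiber_scale /=; congr pair => //=.
by rewrite scalerDr !scalerA mulrC.
Qed.

HB.instance Definition _ a := GRing.isLinear.Build R phase phase _ _
  (fiber_scale_is_linear a).

Lemma fiber_scale_continuous a : continuous (fiber_scale a).
Proof.
move=> z; apply: (@cvg_pair _ _ _ (nbhs z) (nbhs z.1) (nbhs (a *: z.2)) _ _ _
  (fun z : phase => z.1) (fun z : phase => a *: z.2)); first exact: cvg_fst.
by apply: cvgZl_tmp; exact: cvg_snd.
Qed.

Lemma diff_fiber_scale a z : 'd (fiber_scale a) z = fiber_scale a :> (phase -> phase).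
Proof. by apply: diff_lin; exact: fiber_scale_continuous. Qed.

Lemma differentiable_fiber_scale a z : differentiable (fiber_scale a) z.
Proof. by apply: linear_differentiable; exact: fiber_scale_continuous. Qed.

Lemma row_dot_eq (v v' w w' : 'rV[R]_n) :
  v' *m w'^T = v *m w^T -> \sum_k w 0 k * v 0 k = \sum_k w' 0 k * v' 0 k.
Proof.
have dotE (x y : 'rV[R]_n) : \sum_k y 0 k * x 0 k = (x *m y^T) 0 0.
  by rewrite mxE; apply: eq_bigr => k _; rewrite mxE mulrC.
by rewrite !dotE => ->.
Qed.

End PhaseSpace.

(** * Covectors in charts *)

Section Charts.
Context {R : realType} {n : nat} {M : manifold R n}.
Implicit Types (i j : chart M) (p q : cotangent M) (h : cotangent M -> R).
Local Notation phase := ('rV[R]_n * 'rV[R]_n)%type.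

Lemma comp_neq0 i p : dom i (base p) -> nonzero p -> Defs.comp p i != 0.
Proof.
move=> ip [j pj]; apply/eqP => p0; move/eqP: pj; apply.
by rewrite (@covec_unique _ _ _ i (Defs.czero (base p)) p).
Qed.

Lemma covec_comp i p : dom i (base p) -> covec i (base p) (Defs.comp p i) = p.
Proof. by move=> ip; have [] := covecP (Defs.comp p i) ip; exact: covec_unique. Qed.

Lemma local_expr_coord h i p : dom i (base p) ->
  local_expr h i (canonical_coord i p) = h p.
Proof. by move=> ip; rewrite /local_expr /= coordK // covec_comp. Qed.

Lemma canonical_coord_dom i p : dom i (base p) -> nonzero p ->
  canonical_dom i (canonical_coord i p).
Proof. by move=> ip p0; split; [exists (base p)|exact: comp_neq0]. Qed.

Lemma canonical_coord_inj i p q : dom i (base p) -> dom i (base q) ->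
  canonical_coord i p = canonical_coord i q -> p = q.
Proof.
move=> ip iq [xE cE]; apply: (@covec_unique _ _ _ i) => //.
by rewrite -(coordK ip) xE coordK.
Qed.

Lemma nonzero_cscale a p : 0 < a -> nonzero p -> nonzero (Defs.cscale a p).
Proof. by move=> a0 [i pi]; exists i; rewrite /= scaler_eq0 negb_or gt_eqF. Qed.

(** The differential is determined along the directions whose position part has
    nonnegative entries, because they point into the half-space; these directions
    span the phase space. *)
Lemma canonical_dom_unique i (f : phase -> R) z L1 L2 : canonical_dom i z ->
  diff_on (canonical_dom i) f z L1 -> diff_on (canonical_dom i) f z L2 ->
  L1 = L2.
Proof.
move=> zi d1 d2.
have [|O oO OE] := @coord_open _ _ _ i (dom i) (dom_open i) => //.
have [z1 z2] := zi; have [Oz hz] : (O `&` halfspace) z.1 by rewrite -OE.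
have half (v w : 'rV[R]_n) : (forall k, 0 <= v 0 k) -> L1 (v, w) = L2 (v, w).
  move=> v0; apply: (diff_on_dir zi _ d1 d2).
  have c1 : h *: v + z.1 @[h --> (0 : R)^'+] --> z.1.
    rewrite -[X in _ --> X]add0r -(scale0r v).
    apply: cvgD; last exact: cvg_cst.
    by apply: cvgZr_tmp; apply: cvg_at_right_filter; exact: cvg_id.
  have c2 : h *: w + z.2 @[h --> (0 : R)^'+] --> z.2.
    rewrite -[X in _ --> X]add0r -(scale0r w).
    apply: cvgD; last exact: cvg_cst.
    by apply: cvgZr_tmp; apply: cvg_at_right_filter; exact: cvg_id.
  have nO : nbhs z.1 O by exact: open_nbhs_nbhs.
  have nz : nbhs z.2 [set y | y != 0].
    have z20 : 0 < `|z.2| by rewrite normr_gt0.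
    apply/nbhs_ballP; exists `|z.2| => //= y; rewrite -ball_normE /ball_ /=.
    by apply: contraTneq => ->; rewrite subr0 ltxx.
  near=> h; split => /=; last by near: h; exact: (c2 _ nz).
  suff : (O `&` halfspace) (h *: v + z.1) by rewrite -OE.
  split; first by near: h; exact: (c1 _ nO).
  move=> k k0; rewrite !mxE addr_ge0 //; last exact: hz.
  by rewrite mulr_ge0 //; near: h; exact: nbhs_right_ge.
have [g1 [_ _ E1]] := d1; have [g2 [_ _ E2]] := d2.
apply/funext => -[v w].
(* (v, w) is a difference of two directions that point into the half-space. *)
pose a : 'rV[R]_n := map_mx (fun x => `|x|) v.
have -> : (v, w) = (v + a, w) - (a, 0) :> phase by congr pair; rewrite /= ?addrK ?subr0.
have L1B x y : L1 (x - y) = L1 x - L1 y by rewrite E1; exact: (linearB ('d g1 z)).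
have L2B x y : L2 (x - y) = L2 x - L2 y by rewrite E2; exact: (linearB ('d g2 z)).
rewrite L1B L2B; congr (_ - _); apply: half => k; rewrite !mxE //.
by rewrite -lerBlDl sub0r; have := ler_norm (- v 0 k); rewrite normrN.
Unshelve. all: by end_near. Qed.

(** Differentiate the homogeneity relation along a |-> (x, (1 + a) xi) at
    a = 0. *)
Lemma euler_identity h i p dh :
  (forall (a : R) p, 0 < a -> nonzero p -> h (Defs.cscale a p) = a ^+ 2 * h p) ->
  dom i (base p) -> nonzero p -> diff_at h i p dh ->
  dh (0, Defs.comp p i) = 2 * h p.
Proof.
move=> hom ip p0 [g [dg gE ->]].
set z := canonical_coord i p in dg gE *.
pose line (a : R) : phase := a *: ((0, Defs.comp p i) : phase) + z.
have l0 : line 0 = z by rewrite /line scale0r add0r.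
have dl : is_derive (0 : R) (1 : R) (g \o line) ('d g z (0, Defs.comp p i)).
  rewrite -l0; apply: is_derive_chain; first by rewrite l0.
  exact: is_derive_line.
have dq : is_derive (0 : R) (1 : R) (fun a : R => (a + 1) ^+ 2 * h p) (2 * h p).
  have d1 : is_derive (0 : R) (1 : R) (fun a : R => a + 1) 1.
    by rewrite -[X in is_derive _ _ _ X]addr0; exact: is_deriveD.
  have -> : (fun a : R => (a + 1) ^+ 2 * h p) =
    (fun a : R => a + 1) * (fun a : R => a + 1) * cst (h p) by [].
  apply: is_derive_eq.
  rewrite /= !add0r scaler0 add0r !scaler1 /cst /GRing.scale /=; ring.
have E : \forall a \near (0 : R), g (line a) = (a + 1) ^+ 2 * h p.
  have cl : line a @[a --> (0 : R)] --> z.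
    by rewrite -l0; exact: (is_derive_continuous (is_derive_line _ _ 0)).
  rewrite near_withinE in gE.
  near=> a.
  have a1 : 0 < a + 1.
    rewrite -ltrBlDr sub0r; near: a; apply: lt_nbhsr; by rewrite ltrN10.
  have zE : line a = canonical_coord i (Defs.cscale (a + 1) p).
    rewrite /line /z /canonical_coord /=; congr pair; rewrite /= ?scaler0 ?add0r //.
    by rewrite scalerDl scale1r.
  have Az : canonical_dom i (line a).
    rewrite zE; apply: canonical_coord_dom => //; exists i => /=.
    by rewrite scaler_eq0 gt_eqF //= comp_neq0.
  rewrite -hom // -(@local_expr_coord h i (Defs.cscale (a + 1) p)) // -zE.
  by apply/esym; move: Az; near: a; exact: (cl _ gE).
have [_ <-] := dl; have [_ <-] := dq; exact: near_eq_derive.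
Unshelve. all: by end_near. Qed.

Lemma diff_at_cscale h i p dh (a : R) :
  (forall (a : R) p, 0 < a -> nonzero p -> h (Defs.cscale a p) = a ^+ 2 * h p) ->
  0 < a -> dom i (base p) -> diff_at h i p dh ->
  diff_at h i (Defs.cscale a p) (fun z => a ^+ 2 * dh (fiber_scale a^-1 z)).
Proof.
move=> hom a0 ip [g [dg gE ->]].
have aneq : a != 0 by rewrite gt_eqF.
pose s : phase -> phase := fiber_scale a^-1.
set z := canonical_coord i (Defs.cscale a p).
have sz : s z = canonical_coord i p.
  by rewrite /s /z /fiber_scale /canonical_coord /= scalerA mulVf // scale1r.
have ds : differentiable s z by exact: differentiable_fiber_scale.
have dgs : differentiable (g \o s) z.
  by apply: (differentiable_comp ds); rewrite sz.
exists (a ^+ 2 *: (g \o s)); split.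
- exact: differentiableZ.
- rewrite !near_withinE in gE *; rewrite -sz in gE.
  have near_s : \forall y \near z, canonical_dom i (s y) ->
    local_expr h i (s y) = g (s y) by exact: (@fiber_scale_continuous R n a^-1 z _ gE).
  apply: filterS near_s => y sE yi.
  have [[x ix xE] y2] := yi.
  have siy : canonical_dom i (s y).
    by split; [exists x|rewrite /= scaler_eq0 negb_or invr_eq0 aneq].
  have /= := sE siy => gy.
  rewrite /GRing.scale /= -gy.
  have [bE cE] := covecP (a^-1 *: y.2) ix.
  have q0 : nonzero (covec i x (a^-1 *: y.2)).
    by exists i; rewrite cE; case: siy.
  rewrite /local_expr /= -xE coordK //.
  rewrite [RHS](_ : _ = h (Defs.cscale a (covec i x (a^-1 *: y.2)))); last by rewrite hom.
  congr h; have [bE' cE'] := covecP y.2 ix.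
  apply: (@covec_unique _ _ _ i); rewrite /= ?bE ?bE' //.
  by rewrite cE cE' scalerA divff // scale1r.
- have dgs' : differentiable g (s z) by rewrite sz.
  apply/funext => w.
  have E4 : 'd (a ^+ 2 *: (g \o s)) z w = a ^+ 2 * 'd (g \o s) z w :=
    congr1 (@^~ w) (diffZ (a ^+ 2) dgs).
  have E5 : 'd (g \o s) z w = 'd g (s z) ('d s z w) :=
    congr1 (@^~ w) (diff_comp ds dgs').
  apply: etrans (esym E4); congr (_ * _); apply: etrans (esym E5).
  have E6 : 'd s z w = s w := congr1 (@^~ w) (diff_fiber_scale a^-1 z).
  have E7 : 'd g (s z) = 'd g (canonical_coord i p) by rewrite sz.
  by rewrite E7; congr ('d g _ _).
Qed.

End Charts.

(** * Bicharacteristics *)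

Section Bicharacteristics.
Context {R : realType} {n : nat} {M : manifold R n}.
Implicit Types (i j : chart M) (p q : cotangent M) (h : cotangent M -> R).
Implicit Types (c : R -> cotangent M) (T t a : R).
Local Notation phase := ('rV[R]_n * 'rV[R]_n)%type.

(** Inside the time interval, the derivative relative to the interval is the
    usual one. *)
Lemma bicharacteristic_interior h T c t i :
  bicharacteristic h T c -> 0 < t < T -> dom i (base (c t)) ->
  (\forall t' \near t, dom i (base (c t'))) /\
  exists (z' : phase) (dh : {linear phase -> R}),
    [/\ is_derive t (1 : R) (fun t' => canonical_coord i (c t')) z',
        diff_at h i (c t) dh & forall r, phase_coord r z' = hamilton_rhs dh r].
Proof.
move=> bc t0T ic; have t0T' : 0 <= t <= T.
  by have /andP[/ltW -> /ltW ->] := t0T.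
have [_ /(_ i ic)[nd [dc [dh [d1 d2 e1 e2]]]]] := bc t t0T'.
have nt := nbhs_segment t0T.
split; first exact: near_interior nt nd.
have [g [dg gE dcE]] := d1; have [g' [_ _ dhE]] := d2.
exists (dc 1), ('d g' (canonical_coord i (c t))); split.
- apply: (@near_eq_is_derive _ _ _ g).
    by have := near_interior nt gE; apply: filterS => u ->.
  rewrite dcE -deriveE //; apply: derivableP; exact: diff_derivable.
- by rewrite -dhE.
- case=> -[] k; rewrite /hamilton_rhs /phase_coord /= -dhE; [exact: e1|exact: e2].
Qed.

Lemma bicharacteristic_cvg h T c t i :
  bicharacteristic h T c -> 0 <= t <= T -> dom i (base (c t)) ->
  canonical_coord i (c t') @[t' --> within `[0, T] (nbhs t)] -->
    canonical_coord i (c t).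
Proof.
move=> bc t0T ic.
have [_ /(_ i ic)[_ [dc [dh [d1 _ _ _]]]]] := bc t t0T.
by apply: diff_on_cvg d1; rewrite /= in_itv.
Qed.

(** The symplectic pairing of the velocity with itself vanishes. *)
Lemma energy_conserved h T c t :
  bicharacteristic h T c -> 0 <= t <= T -> h (c t) = h (c 0).
Proof.
move=> bc t0T.
have cont : {within `[0, T], continuous (fun t => h (c t))}.
  apply/subspace_continuousP => u /=; rewrite in_itv /= => uT.
  have [i ic] := dom_cover (base (c u)).
  have [c0 /(_ i ic)[nd [dc [dh [d1 d2 _ _]]]]] := bc u uT.
  have Az := canonical_coord_dom ic c0.
  have cz := bicharacteristic_cvg bc uT ic.
  have ch := diff_on_cvg Az d2.
  have nA : \forall t' \near within `[0, T] (nbhs u),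
      dom i (base (c t')) /\ canonical_dom i (canonical_coord i (c t')).
    rewrite near_withinE in nd *; apply: filterS nd => t' + tT => /(_ tT) it'.
    split => //; apply: canonical_coord_dom => //.
    by rewrite /= in_itv in tT; have [] := bc t' tT.
  rewrite [X in _ --> X](_ : _ = local_expr h i (canonical_coord i (c u))); last first.
    by rewrite local_expr_coord.
  apply: (@cvg_trans _ (local_expr h i (canonical_coord i (c t'))
    @[t' --> within `[0, T] (nbhs u)])).
    by apply: near_eq_cvg; apply: filterS nA => t' [it' _]; rewrite local_expr_coord.
  move=> P nP.
  have : \forall z \near within (canonical_dom i) (nbhs (canonical_coord i (c u))),
    P (local_expr h i z) by exact: (ch _ nP).
  rewrite near_withinE => NP.
  have := cz _ NP.
  apply: filterS2 nA => t' [_ At']; exact.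
have der u : 0 < u < T -> is_derive u (1 : R) (fun t => h (c t)) 0.
  move=> uT; have [i ic] := dom_cover (base (c u)).
  have uT' : 0 <= u <= T by have /andP[/ltW -> /ltW ->] := uT.
  have [nd [z' [dh [dz dhE zE]]]] := bicharacteristic_interior bc uT ic.
  have [g [dg gE dhg]] := dhE.
  have nt := nbhs_segment uT.
  have dgz := is_derive_chain dg dz.
  have -> : 0 = 'd g (canonical_coord i (c u)) z'.
    rewrite -dhg (differential_pairing z' zE); apply/esym/big1 => k _.
    by rewrite mulrC subrr.
  apply: near_eq_is_derive dgz.
  have cz := is_derive_continuous dz.
  rewrite near_withinE in gE; have := cz _ gE.
  apply: filterS3 nt nd => t' tT it' /=; rewrite -(local_expr_coord h it') => <- //.
  apply: canonical_coord_dom => //.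
  by rewrite /= in_itv in tT; have [] := bc t' tT.
have /andP[t0 tT] := t0T.
have [||a _] := @MVT_segment R (fun t => h (c t)) (fun=> 0) 0 t t0.
- move=> u /[!in_itv] /= /andP[u0 ut]; apply: der; rewrite u0.
  exact: lt_le_trans ut tT.
- by apply: continuous_subspaceW cont; apply: subset_itvl; rewrite bnd_simp.
by rewrite mul0r => /eqP; rewrite subr_eq0 => /eqP.
Qed.

(** Both of Hamilton's equations are preserved: the velocity of the position is
    multiplied by a, as the derivative in xi of a function homogeneous of degree
    two, and the velocity of the momentum by a^2, as its derivative in x. *)
Lemma rescaled_bicharacteristic h T c a :
  (forall (a : R) p, 0 < a -> nonzero p -> h (Defs.cscale a p) = a ^+ 2 * h p) ->
  0 < a -> bicharacteristic h T c ->
  bicharacteristic h (T / a) (fun t => Defs.cscale a (c (a * t))).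
Proof.
move=> hom a0 bc t /andP[t0 tT].
have seg u : `[0, T / a]%classic u -> `[0, T]%classic (a * u).
  rewrite /= !in_itv /= => /andP[u0 uT]; rewrite mulr_ge0 ?(ltW a0) //=.
  by rewrite mulrC -ler_pdivlMr.
have tA : `[0, T / a]%classic t by rewrite /= in_itv /= t0.
have uA : 0 <= a * t <= T by have := seg t tA; rewrite /= in_itv.
have [c0 H] := bc _ uA; split; first exact: nonzero_cscale.
move=> i ic; have {H}[nd [dc [dh [d1 d2 e1 e2]]]] := H i ic.
have [g [dg gE dcE]] := d1; have [g' [_ _ dhE]] := d2.
have ca : (a * t') @[t' --> t] --> a * t by apply: cvgM; [exact: cvg_cst|exact: cvg_id].
split.
  rewrite !near_withinE in nd *.
  have near_a : \forall t' \near t, `[0, T]%classic (a * t') -> dom i (base (c (a * t')))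
    by exact: (ca _ nd).
  by apply: filterS near_a => u H /seg; exact: H.
exists (fun u => fiber_scale a (dc (a * u))), (fun z => a ^+ 2 * dh (fiber_scale a^-1 z)).
split.
- have da : differentiable (fun u : R => a * u) t by exact: ex_diff.
  have dga : differentiable (g \o (fun u : R => a * u)) t by exact: differentiable_comp.
  exists (fiber_scale a \o (g \o (fun u : R => a * u))); split.
  + apply: differentiable_comp => //; exact: differentiable_fiber_scale.
  + rewrite !near_withinE in gE *.
    have near_a : \forall t' \near t, `[0, T]%classic (a * t') ->
      canonical_coord i (c (a * t')) = g (a * t') by exact: (ca _ gE).
    by apply: filterS near_a => u H /seg /H /= <-.
  + apply/funext => w.
    have E1 : 'd (fiber_scale a \o (g \o (fun u : R => a * u))) t w =
      'd (fiber_scale a) (g (a * t)) ('d (g \o (fun u : R => a * u)) t w) :=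
      congr1 (@^~ w) (diff_comp dga (differentiable_fiber_scale a _)).
    have E2 : 'd (g \o (fun u : R => a * u)) t w =
      'd g (a * t) ('d (fun u : R => a * u) t w) :=
      congr1 (@^~ w) (diff_comp da dg).
    have E3 : 'd (fun u : R => a * u) t w = a * w.
      by rewrite (_ : (fun u : R => a * u) = *:%R a) // diff_val.
    apply: etrans (esym E1).
    apply: etrans (esym (congr1 (@^~ _) (diff_fiber_scale a _))).
    congr (fiber_scale a _); apply: etrans (esym E2).
    by rewrite dcE E3.
- exact: diff_at_cscale.
- have dcZ : dc a = a *: dc 1 by rewrite dcE -linearZ /= [a *: _]mulr1.
  have dhZ b z : dh (b *: z) = b * dh z by rewrite dhE linearZ.
  move=> k; rewrite mulr1 dcZ /= mxE e1.
  have -> : fiber_scale a^-1 (0, delta_mx 0 k) = a^-1 *: ((0, delta_mx 0 k) : phase).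
    by rewrite /fiber_scale /=; congr pair; rewrite scaler0.
  by rewrite dhZ mulrA expr2 mulfK // gt_eqF.
- have dcZ : dc a = a *: dc 1 by rewrite dcE -linearZ /= [a *: _]mulr1.
  move=> k; rewrite mulr1 dcZ /= !mxE e2.
  have -> : fiber_scale a^-1 (delta_mx 0 k, 0) = (delta_mx 0 k, 0).
    by rewrite /fiber_scale /= scaler0.
  by rewrite mulrA -expr2 mulrN.
Qed.

(** In a chart, the Hamiltonian extends to a C^2 function near the common
    covector, so that its Hamiltonian vector field is Lipschitz there. *)
Lemma bicharacteristic_local_uniqueness h T c1 c2 a :
  (forall i, smooth_on (canonical_dom i) (local_expr h i)) ->
  bicharacteristic h T c1 -> bicharacteristic h T c2 ->
  0 <= a < T -> c1 a = c2 a ->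
  exists2 b, a < b <= T & forall t, a <= t <= b -> c1 t = c2 t.
Proof.
move=> sm b1 b2 /andP[a0 aT] ca.
have aT' : 0 <= a <= T by rewrite a0 ltW.
have [i ia] := dom_cover (base (c1 a)).
have [c10 _] := b1 a aT'.
have [U [g [oU Uz Cg gE]]] := sm i _ (canonical_coord_dom ia c10).
have [K [B [K0 nB BU lip]]] := hamilton_rhs_lipschitz oU Uz (Cg 2%N).
have nearB c : bicharacteristic h T c -> c a = c1 a ->
    \forall t \near a, 0 <= t <= T ->
      dom i (base (c t)) /\ B (canonical_coord i (c t)).
  move=> bc cE; have ic : dom i (base (c a)) by rewrite cE.
  have [_ /(_ i ic)[nd _]] := bc a aT'.
  have := bicharacteristic_cvg bc aT' ic; rewrite cE => /(_ _ nB) nc.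
  have nc' : \forall t \near a, `[0, T]%classic t ->
    B (canonical_coord i (c t)) by exact: nc.
  rewrite near_withinE in nd.
  apply: filterS2 nd nc' => t d1 d2 tT.
  by split; [apply: d1|apply: d2]; rewrite /= in_itv.
have N := filterI (nearB _ b1 erefl) (nearB _ b2 (esym ca)).
have [d /= d0 dN] := (nbhs_ballP _ _).1 (N _).
(* l keeps the curves in the chart and in B, does not go past T, and makes
   K * l < 1. *)
pose l := Order.min (d / 2) (Order.min (T - a) (K + 1)^-1).
have K1 : 0 < K + 1 by rewrite ltr_wpDl.
have l0 : 0 < l by rewrite !lt_min divr_gt0 //= subr_gt0 aT invr_gt0.
have ld : l < d.
  by rewrite gt_min ltr_pdivrMr // ltr_pMr ?ltr1n.
have lT : l <= T - a by rewrite ge_min ge_min lexx orbT.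
have lK : l <= (K + 1)^-1 by rewrite ge_min ge_min lexx !orbT.
have bT : a + l <= T by rewrite addrC -lerBrDr.
have sub t : a <= t <= a + l -> 0 <= t <= T.
  by move=> /andP[at_ tb]; rewrite (le_trans a0 at_) (le_trans tb bT).
have loc t : a <= t <= a + l ->
    [/\ dom i (base (c1 t)), B (canonical_coord i (c1 t)),
     dom i (base (c2 t)) & B (canonical_coord i (c2 t))].
  move=> tab; have /andP[at_ tb] := tab.
  have bt : ball a d t.
    rewrite -ball_normE /ball_ /= distrC ger0_norm ?subr_ge0 //.
    by rewrite ltrBlDl; apply: le_lt_trans tb _; rewrite ltrD2l.
  by have [H1 H2] := dN t bt; have [] := H1 (sub t tab); have [] := H2 (sub t tab).
have contz c : bicharacteristic h T c ->
    (forall t, a <= t <= a + l -> dom i (base (c t))) ->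
    {within `[a, a + l], continuous (fun t => canonical_coord i (c t))}.
  move=> bc ic; apply/subspace_continuousP => t /=; rewrite in_itv /= => tab.
  apply: cvg_trans (bicharacteristic_cvg bc (sub t tab) (ic t tab)).
  apply: cvg_app; apply: within_subset => u /=; rewrite !in_itv /=; exact: sub.
have derz c : bicharacteristic h T c ->
    (forall t, a <= t <= a + l ->
      dom i (base (c t)) /\ B (canonical_coord i (c t))) ->
    forall r t, a < t < a + l -> is_derive t (1 : R)
      (phase_coord r \o (fun t => canonical_coord i (c t)))
      (hamilton_rhs ('d g (canonical_coord i (c t))) r).
  move=> bc ic r t /andP[at_ tb].
  have tab : a <= t <= a + l by rewrite !ltW.
  have [it Bt] := ic t tab.
  have tT : 0 < t < T by rewrite (le_lt_trans a0 at_) (lt_le_trans tb bT).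
  have [_ [z' [dh [dz dhE zE]]]] := bicharacteristic_interior bc tT it.
  have [ct0 _] := bc t (sub t tab).
  have Ug := Ck_diff_on oU (BU _ Bt) (Cg 1%N) gE.
  have E := canonical_dom_unique (canonical_coord_dom it ct0) dhE Ug.
  rewrite -E -zE; apply: is_derive_linear_comp dz.
  exact: phase_coord_continuous.
exists (a + l); first by rewrite ltrDl l0.
have Kl : K * (a + l - a) < 1.
  rewrite addrC addKr; apply: (@le_lt_trans _ _ (K * (K + 1)^-1)).
    by rewrite ler_wpM2l.
  by rewrite ltr_pdivrMr // mul1r ltrDl.
move=> t tab; have [i1 _ i2 _] := loc t tab.
apply: (canonical_coord_inj i1 i2).
apply: (@forward_uniqueness R n (fun t => canonical_coord i (c1 t))
  (fun t => canonical_coord i (c2 t)) B (fun r z => hamilton_rhs ('d g z) r)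
  K a (a + l) K0 _ Kl lip _ _ _ _ _ _ t tab).
- by rewrite lerDl ltW.
- by move=> u /loc[].
- by apply: contz b1 _ => u /loc[].
- by apply: contz b2 _ => u /loc[].
- by apply: derz b1 _ => u /loc[].
- by apply: derz b2 _ => u /loc[].
- by rewrite ca.
Qed.

(** The definition of bicharacteristics only gives continuity in charts. Charts
    are open maps, so this is continuity for the topology of M, and limits can be
    compared using that M is Hausdorff. *)
Lemma bicharacteristic_base_cvg h T c t :
  bicharacteristic h T c -> 0 <= t <= T ->
  base (c t') @[t' --> within `[0, T] (nbhs t)] --> base (c t).
Proof.
move=> bc tT; have [i it] := dom_cover (base (c t)).
have [_ /(_ i it)[nd _]] := bc t tT.
have cz := bicharacteristic_cvg bc tT it.
move=> N nN.
have nNi : nbhs (base (c t)) (N `&` dom i).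
  apply: filterI => //; apply: open_nbhs_nbhs; split => //; exact: dom_open.
have := nNi; rewrite nbhsE => -[N' [oN' N't] N'N].
have [Q oQ QE] := @coord_open _ _ _ i N' oN' (fun x H => (N'N x H).2).
have [Q' _ QE'] := @coord_open _ _ _ i (dom i) (dom_open i) (@subset_refl _ _).
have Ot : Q (canonical_coord i (c t)).1.
  have : (Q `&` halfspace) (Defs.coord i (base (c t))); last by case.
  by rewrite -QE; exists (base (c t)).
have nO : nbhs (canonical_coord i (c t)).1 Q by exact: open_nbhs_nbhs.
have nO2 : nbhs (canonical_coord i (c t)) [set z | Q z.1] by exact: cvg_fst.
have ncO : \forall t' \near within `[0, T] (nbhs t), Q (canonical_coord i (c t')).1.
  exact: (cz _ nO2).
suff : \forall t' \near within `[0, T] (nbhs t), N (base (c t')) by [].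
apply: filterS2 nd ncO => t' it' Ot'.
have Ht' : (Q' `&` halfspace) (Defs.coord i (base (c t'))).
  by rewrite -QE'; exists (base (c t')).
have : (Q `&` halfspace) (Defs.coord i (base (c t'))) by split => //; case: Ht'.
rewrite -QE => -[y N'y yE].
have [Ny iy] := N'N y N'y.
by rewrite -(coordK it') -yE coordK.
Qed.

(** The two curves agree up to the supremum s of the times until which they
    agree, by continuity, and [bicharacteristic_local_uniqueness] excludes
    s < T. *)
Theorem bicharacteristic_uniqueness h T c1 c2 t :
  (forall i, smooth_on (canonical_dom i) (local_expr h i)) ->
  bicharacteristic h T c1 -> bicharacteristic h T c2 ->
  c1 0 = c2 0 -> 0 <= t <= T -> c1 t = c2 t.
Proof.
move=> sm b1 b2 c0 /andP[t0 tT].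
have T0 : 0 <= T := le_trans t0 tT.
pose S := [set s | 0 <= s <= T /\ forall u, 0 <= u <= s -> c1 u = c2 u].
have S0 : S 0.
  split; first by rewrite lexx.
  by move=> u; rewrite -eq_le => /eqP <-.
have hS : has_sup S by split; [exists 0|exists T => s [/andP[]]].
pose s := sup S.
have s0 : 0 <= s by apply: ub_le_sup => //; case: hS.
have sT : s <= T by apply: ge_sup; [exists 0|move=> u [/andP[]]].
have below u : 0 <= u < s -> c1 u = c2 u.
  move=> /andP[u0 us]; have [v [_ vE] uv] := sup_gt (ex_intro _ 0 S0) us.
  by apply: vE; rewrite u0 ltW.
have at_s : c1 s = c2 s.
  move: s0; rewrite le_eqVlt => /predU1P[<- //|s0].
  have sT' : 0 <= s <= T by rewrite ltW.
  have sT'' : 0 < s <= T by rewrite s0.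
  have wl := within_at_left sT''.
  have nb : \forall u \near s^'-, c1 u = c2 u.
    near=> u; apply: below; apply/andP; split; last by near: u; exact: nbhs_left_lt.
    by apply: ltW; near: u; exact: nbhs_left_gt.
  have cb c : bicharacteristic h T c -> base (c u) @[u --> s^'-] --> base (c s).
    move=> bc; apply: cvg_trans (bicharacteristic_base_cvg bc sT').
    by apply: cvg_app.
  have bE : base (c1 s) = base (c2 s).
    apply: (@cvg_unique _ (@manifold_hausdorff _ _ M) (base (c1 u) @[u --> s^'-])).
      exact: cb.
    apply: cvg_trans (cb _ b2); apply: near_eq_cvg.
    by apply: filterS nb => u ->.
  have [i i1] := dom_cover (base (c1 s)).
  have i2 : dom i (base (c2 s)) by rewrite -bE.
  apply: (canonical_coord_inj i1 i2).
  have cc c : bicharacteristic h T c -> dom i (base (c s)) ->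
      canonical_coord i (c u) @[u --> s^'-] --> canonical_coord i (c s).
    move=> bc ic; apply: cvg_trans (bicharacteristic_cvg bc sT' ic).
    by apply: cvg_app.
  have H : hausdorff_space phase by exact: norm_hausdorff.
  apply: (@cvg_unique _ H (canonical_coord i (c1 u) @[u --> s^'-])).
    exact: cc.
  apply: cvg_trans (cc _ b2 i2); apply: near_eq_cvg.
  by apply: filterS nb => u ->.
have upto u : 0 <= u <= s -> c1 u = c2 u.
  move=> /andP[u0]; rewrite le_eqVlt => /predU1P[-> //|us].
  by apply: below; rewrite u0.
have sE : s = T.
  apply/eqP; rewrite eq_le sT leNgt; apply/negP => slT.
  have sT' : 0 <= s < T by rewrite s0.
  have [b /andP[sb bT] bE] := bicharacteristic_local_uniqueness sm b1 b2 sT' at_s.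
  have Sb : S b.
    split; first by rewrite bT (le_trans s0 (ltW sb)).
    move=> u /andP[u0 ub]; case: (leP u s) => us; first by apply: upto; rewrite u0.
    by apply: bE; rewrite ub ltW.
  have : b <= s by apply: ub_le_sup => //; case: hS.
  by rewrite leNgt sb.
by apply: upto; rewrite t0 sE.
Unshelve. all: by end_near. Qed.

End Bicharacteristics.

(** * The first variation *)

Section Variation.
Context {R : realType} {n : nat} {M : manifold R n} (eps : R)
  (H : R -> cotangent M -> R) (c : R -> R -> cotangent M).
Local Notation phase := ('rV[R]_n * 'rV[R]_n)%type.
Implicit Types (i j : chart M) (s t : R).

(** Near the time t0 and the parameter 0, the curves and the Hamiltonians read in
    the chart i coincide with functions g and h that are smooth on open sets, so
    that two-sided derivatives make sense even if t0 is an end of [0, 1] or if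
    the curve meets the boundary of M. *)
Record chart_model i t0 (U : set (R * R)) (g : R * R -> phase)
    (N : set (phase * R)) (h : phase * R -> R) : Prop := ChartModel {
  model_openU : open U ;
  model_openN : open N ;
  model_Ckg : forall k, Ck k U g ;
  model_Ckh : forall k, Ck k N h ;
  model_near : \forall w \near (0, t0), [/\ U w, N (g w, w.1) &
    `|w.1| < eps -> 0 <= w.2 <= 1 ->
      dom i (base (c w.1 w.2)) /\ canonical_coord i (c w.1 w.2) = g w] ;
  model_h : forall z s, canonical_dom i z -> `|s| < eps -> N (z, s) ->
    local_expr (H s) i z = h (z, s)
}.

Context (eps_gt0 : 0 < eps) (H_smooth : smooth_family eps H)
  (c_smooth : smooth_map [set w : R * R | `|w.1| < eps /\ 0 <= w.2 <= 1]
                         (fun w => c w.1 w.2))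
  (c_bichar : forall s, `|s| < eps -> bicharacteristic (H s) 1 (c s))
  (H_homogeneous : forall s, `|s| < eps -> forall (a : R) p, 0 < a ->
    nonzero p -> H s (Defs.cscale a p) = a ^+ 2 * H s p).

Let eps0 : `|0 : R| < eps. Proof. by rewrite normr0. Qed.

Lemma chart_model_exists i t0 : 0 <= t0 <= 1 -> dom i (base (c 0 t0)) ->
  exists U g N h, chart_model i t0 U g N h.
Proof.
move=> t01 ic.
pose A := [set w : R * R | `|w.1| < eps /\ 0 <= w.2 <= 1].
have Aw : A (0, t0) by split.
have [U0 [oU0 U0w domU0 smU0]] := c_smooth Aw ic.
have [U [g [oU Uw Cg gE]]] := smU0 (0, t0) (conj U0w Aw).
have [c0 _] := c_bichar eps0 t01.
have Dz : canonical_dom i (canonical_coord i (c 0 t0)) /\ `|0 : R| < eps.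
  by split => //; exact: canonical_coord_dom.
have [N [h [oN Nz Ch hE]]] := @H_smooth i (canonical_coord i (c 0 t0), 0) Dz.
exists U, g, N, h; split => //.
have g0 : g (0, t0) = canonical_coord i (c 0 t0) by rewrite -gE.
have cgw : (g w, w.1) @[w --> ((0 : R), t0)] --> (g (0, t0), 0 : R).
  apply: (@cvg_pair _ _ _ (nbhs ((0 : R), t0)) (nbhs (g (0, t0))) (nbhs (0 : R))
    _ _ _ g (fun w : R * R => w.1)).
    exact: (Cg 0%N).
  exact: cvg_fst.
rewrite -g0 in Nz.
have nN : nbhs (g (0, t0), 0 : R) N by exact: open_nbhs_nbhs.
have nU : nbhs ((0 : R), t0) U by exact: open_nbhs_nbhs.
have nU0 : nbhs ((0 : R), t0) U0 by exact: open_nbhs_nbhs.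
have nNw : \forall w \near ((0 : R), t0), N (g w, w.1) by exact: (cgw _ nN).
- apply: filterS3 nU nU0 nNw => w Uww U0ww Nw; split => // w1 w2.
  have Aww : A w by split.
  by split; [exact: domU0|rewrite -gE].
- by move=> z s iz se Nz'; rewrite -(hE (z, s)).
Qed.

Lemma model_near_slice i t0 U g N h : chart_model i t0 U g N h ->
  \forall t \near t0, \forall s \near (0 : R), `|s| < eps /\
    [/\ U (s, t), N (g (s, t), s) & 0 <= t <= 1 ->
      [/\ dom i (base (c s t)), canonical_coord i (c s t) = g (s, t) &
          forall s', `|s'| < eps -> N (g (s, t), s') -> H s' (c s t) = h (g (s, t), s')]].
Proof.
move=> [_ _ _ _ nm hE].
have neps : \forall s \near (0 : R), `|s| < eps := nbhs0_lt eps_gt0.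
have := near_slice2 (near_join nm); apply: filterS => t /near_slice1 nt.
apply: filterS2 neps nt => s se [Us Ns E]; split => //; split => // t01.
have [it gE] := E se t01; split => // s' se' Ns'.
have [c0 _] := c_bichar se t01.
rewrite -(local_expr_coord (H s') it) gE hE // -gE; exact: canonical_coord_dom.
Qed.

Definition variation i t : phase :=
  'D_1 (fun s => canonical_coord i (c s t)) 0.

Definition momentum_variation i t : R :=
  \sum_k (canonical_coord i (c 0 t)).2 0 k * (variation i t).1 0 k.

Lemma variation_model i t0 U g N h : chart_model i t0 U g N h ->
  \forall t \near t0, 0 <= t <= 1 ->
    is_derive (0 : R) (1 : R) (fun s => canonical_coord i (c s t)) ('D_(1, 0) g (0, t)).
Proof.
move=> mod; apply: filterS (model_near_slice mod) => t nt t01.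
have [_ [Ut _ _]] := nbhs_singleton nt.
have [dg _] := model_Ckg mod 1%N.
apply: (near_eq_is_derive _ (is_derive_slice1 (dg _ Ut))).
by apply: filterS nt => s [_ [_ _ /(_ t01) [_ -> _]]].
Qed.

Lemma is_derive_variation i t : 0 <= t <= 1 -> dom i (base (c 0 t)) ->
  is_derive (0 : R) (1 : R) (fun s => canonical_coord i (c s t)) (variation i t).
Proof.
move=> t01 it; have [U [g [N [h mod]]]] := chart_model_exists t01 it.
have := nbhs_singleton (variation_model mod) => /(_ t01) D.
by rewrite /variation; case: D => D _; exact: derivableP.
Qed.

Lemma dom_near i t : 0 <= t <= 1 -> dom i (base (c 0 t)) ->
  \forall s \near (0 : R), `|s| < eps /\ dom i (base (c s t)).
Proof.
move=> t01 it; have [U [g [N [h mod]]]] := chart_model_exists t01 it.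
have := nbhs_singleton (model_near_slice mod); apply: filterS => s.
by move=> [se [_ _ /(_ t01)[]]].
Qed.

(** Tangent vectors are transported by the differential of the transition map
    and covectors by its transpose. *)
Lemma momentum_variation_chart i j t : 0 <= t <= 1 ->
  dom i (base (c 0 t)) -> dom j (base (c 0 t)) ->
  momentum_variation i t = momentum_variation j t.
Proof.
move=> t01 it jt.
have [L dL LE] := comp_compat it jt.
have di := is_derive_fst (is_derive_variation t01 it).
have dj := is_derive_fst (is_derive_variation t01 jt).
have [gT [dgT gTE LgT]] := dL.
have dgi := is_derive_chain dgT di.
have vj : (variation j t).1 = L (variation i t).1.
  have [_ Ej] := dj; have [_ Ei] := dgi; rewrite LgT.
  apply: etrans (esym Ej) _; apply: etrans _ Ei.
  apply: near_eq_derive.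
  have ci := is_derive_continuous di.
  rewrite near_withinE in gTE.
  have nT : \forall s \near (0 : R), overlap i j (canonical_coord i (c s t)).1 ->
    transition i j (canonical_coord i (c s t)).1 = gT (canonical_coord i (c s t)).1.
    exact: (ci _ gTE).
  apply: filterS3 nT (dom_near t01 it) (dom_near t01 jt) => s E [_ is_] [_ js].
  rewrite /= -E; last by exists (base (c s t)).
  by rewrite /transition /= coordK.
apply: (@row_dot_eq _ _ (variation i t).1 (variation j t).1 (Defs.comp (c 0 t) i)).
exact: etrans (congr1 (fun x => x *m (Defs.comp (c 0 t) j)^T) vj) (LE _).
Qed.

Lemma momentum_variation_fixed i t : 0 <= t <= 1 -> dom i (base (c 0 t)) ->
  (forall s, `|s| < eps -> base (c s t) = base (c 0 t)) ->
  momentum_variation i t = 0.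
Proof.
move=> t01 it fixed; have [_ vE] := is_derive_fst (is_derive_variation t01 it).
rewrite /momentum_variation -vE; apply: big1 => k _.
have -> : 'D_1 (fun s => (canonical_coord i (c s t)).1) 0 = 0 :> 'rV[R]_n.
  rewrite -(derive_cst (Defs.coord i (base (c 0 t))) (0 : R) (1 : R)).
  apply: near_eq_derive; apply: filterS (dom_near t01 it) => s [se _].
  by rewrite /= fixed.
by rewrite mxE mulr0.
Qed.

(** The function xi . x_s of the time. The chart used at each time is irrelevant
    by [momentum_variation_chart]. *)
Definition boundary_term t : R :=
  momentum_variation (sval (cid (dom_cover (base (c 0 t))))) t.

Lemma boundary_termE i t : 0 <= t <= 1 -> dom i (base (c 0 t)) ->
  boundary_term t = momentum_variation i t.
Proof.
move=> t01 it; apply: momentum_variation_chart => //.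
by case: cid.
Qed.

Lemma boundary_term_model i t0 U g N h : chart_model i t0 U g N h ->
  \forall t \near t0, 0 <= t <= 1 -> boundary_term t =
    \sum_k phase_coord (false, k) (g (0, t)) *
           phase_coord (true, k) ('D_(1, 0) g (0, t)).
Proof.
move=> mod; apply: filterS2 (model_near_slice mod) (variation_model mod).
move=> t nt dt t01; have [_ [_ _ /(_ t01)[it gE _]]] := nbhs_singleton nt.
rewrite (boundary_termE t01 it) /momentum_variation gE.
by have [_ vE] := dt t01; rewrite /variation vE.
Qed.

Lemma energy_is_constant s t : `|s| < eps -> 0 <= t <= 1 -> H s (c s t) = H s (c s 0).
Proof. by move=> se t01; exact: energy_conserved (c_bichar se) t01. Qed.

Lemma is_derive_energy i t0 U g N h : chart_model i t0 U g N h -> 0 <= t0 <= 1 ->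
  is_derive (0 : R) (1 : R) (fun s => H s (c s 0))
    ('d h (g (0, t0), 0) ('D_(1, 0) g (0, t0), 1)).
Proof.
move=> mod t01; have nt := nbhs_singleton (model_near_slice mod).
have [_ [U0 N0 _]] := nbhs_singleton nt.
have [dg _] := model_Ckg mod 1%N; have [dh _] := model_Ckh mod 1%N.
have dgs := is_derive_pair (is_derive_slice1 (dg _ U0)) (is_derive_id (0 : R) (1 : R)).
apply: (near_eq_is_derive _ (is_derive_chain (dh _ N0) dgs)).
apply: filterS nt => s [se [_ Ns /(_ t01) [_ _ E]]].
by rewrite /= -(energy_is_constant se t01) E.
Qed.

Lemma is_derive_param_model i t0 U g N h : chart_model i t0 U g N h ->
  \forall t \near t0, 0 <= t <= 1 ->
    is_derive (0 : R) (1 : R) (fun s => H s (c 0 t)) ('D_(0, 1) h (g (0, t), 0)).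
Proof.
move=> mod; apply: filterS (model_near_slice mod) => t nt t01.
have [_ [_ N0 /(_ t01)[_ _ E]]] := nbhs_singleton nt.
have [dh _] := model_Ckh mod 1%N.
have dz := is_derive_pair (is_derive_cst (g (0, t)) (0 : R) (1 : R))
  (is_derive_id (0 : R) (1 : R)).
rewrite (deriveE _ (dh _ N0)).
apply: (near_eq_is_derive _ (is_derive_chain (dh _ N0) dz)).
have cz : (g (0, t), s) @[s --> (0 : R)] --> (g (0, t), 0 : R).
  exact: is_derive_continuous dz.
have nN : nbhs (g (0, t), 0 : R) N.
  by apply: open_nbhs_nbhs; split => //; exact: model_openN mod.
have nNs : \forall s \near (0 : R), N (g (0, t), s) by exact: (cz _ nN).
by apply: filterS2 nNs nt => s Ns [se _]; rewrite /= E.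
Qed.

Lemma param_deriv_model i t0 U g N h : chart_model i t0 U g N h ->
  \forall t \near t0, 0 <= t <= 1 ->
    param_deriv H (c 0 t) 0 = 'D_(0, 1) h (g (0, t), 0).
Proof.
move=> mod; apply: filterS (is_derive_param_model mod) => t + t01 => /(_ t01)[_ <-].
by rewrite /param_deriv derive1E.
Qed.

Lemma param_deriv_cscale (a : R) t : 0 < a -> 0 <= t <= 1 ->
  param_deriv H (Defs.cscale a (c 0 t)) 0 = a ^+ 2 * param_deriv H (c 0 t) 0.
Proof.
move=> a0 t01; have [i it] := dom_cover (base (c 0 t)).
have [U [g [N [h mod]]]] := chart_model_exists t01 it.
have dH := nbhs_singleton (is_derive_param_model mod) t01.
have [c0 _] := c_bichar eps0 t01.
rewrite /param_deriv !derive1E.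
have dHa := is_deriveZ (a ^+ 2) dH.
have [_ E] := dH; have [_ Ea] := dHa; rewrite E; apply: etrans _ Ea.
apply: near_eq_derive; apply: filterS (dom_near t01 it) => s [se _].
by rewrite H_homogeneous.
Qed.

(** At interior times, the derivative of the extension g in time is the velocity
    of the bicharacteristic. *)
Lemma time_derivative_model i t0 U g N h : chart_model i t0 U g N h -> 0 < t0 < 1 ->
  \forall s \near (0 : R), exists dh : {linear phase -> R},
    [/\ `|s| < eps, dom i (base (c s t0)), canonical_coord i (c s t0) = g (s, t0),
        diff_at (H s) i (c s t0) dh &
        forall r, phase_coord r ('D_(0, 1) g (s, t0)) = hamilton_rhs dh r].
Proof.
move=> mod t01; have t01' : 0 <= t0 <= 1 by have /andP[/ltW -> /ltW ->] := t01.
have [_ _ Cg _ nm _] := mod.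
have := near_slice1 (near_join nm).
apply: filterS2 (nbhs_singleton (model_near_slice mod)).
move=> s [se [Us _ /(_ t01')[is_ gE _]]] ns.
have [_ [z' [dh [dz dhE zE]]]] := bicharacteristic_interior (c_bichar se) t01 is_.
exists dh; split => // r; rewrite -zE; congr phase_coord.
have [dg _] := Cg 1%N.
have [_ <-] := is_derive_slice2 (dg _ Us); have [_ <-] := dz.
apply: near_eq_derive.
apply: filterS2 (nbhs_segment t01) (near_slice2 ns) => t /=; rewrite in_itv /= => t01t.
by move=> [_ _ /(_ se t01t)[_ ->]].
Qed.

Lemma is_derive_boundary_sum i t0 U g N h : chart_model i t0 U g N h ->
  is_derive t0 (1 : R) (fun t => \sum_k phase_coord (false, k) (g (0, t)) *
    phase_coord (true, k) ('D_(1, 0) g (0, t)))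
  (\sum_k phase_coord (false, k) ('D_(0, 1) g (0, t0)) *
           phase_coord (true, k) ('D_(1, 0) g (0, t0)) +
   \sum_k phase_coord (false, k) (g (0, t0)) *
           phase_coord (true, k) ('D_(0, 1) ('D_(1, 0) g) (0, t0))).
Proof.
move=> mod; have [_ [U0 _ _]] := nbhs_singleton (nbhs_singleton (model_near_slice mod)).
have [dg Cg1] := model_Ckg mod 2%N; have [dg1 _] := Cg1 (1, 0).
have cP r := @phase_coord_continuous R n r.
apply: is_derive_dot => k.
  exact: (is_derive_linear_comp (cP _) (is_derive_slice2 (dg _ U0))).
exact: (is_derive_linear_comp (cP _) (is_derive_slice2 (dg1 _ U0))).
Qed.

(** The sums S11, S12, S21 and S22 stand for xi_t . x_s, xi . x_st, xi_s . x_t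
    and xi . x_ts. *)
Lemma energy_variation_split (S11 S12 S21 S22 E' F1 Hs : R) :
  F1 = S11 + S12 -> 2 * E' = S21 + S22 -> S12 = S22 -> E' = S21 - S11 + Hs ->
  F1 = E' + Hs.
Proof. lra. Qed.

(** The derivative of xi . x_s is xi_t . x_s + xi . x_st. The second term is
    2 E' - xi_s . x_t, by differentiation of 2 E = xi . x_t in s, and the
    remaining terms are those of E' = xi_s . x_t - x_s . xi_t + H_s. *)
Lemma is_derive_boundary_term t0 : 0 < t0 < 1 ->
  is_derive t0 (1 : R) boundary_term
    ('D_1 (fun s => H s (c s 0)) 0 + param_deriv H (c 0 t0) 0).
Proof.
move=> t01; have t01' : 0 <= t0 <= 1 by have /andP[/ltW -> /ltW ->] := t01.
have [i it] := dom_cover (base (c 0 t0)).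
have [U [g [N [h mod]]]] := chart_model_exists t01' it.
have nt := nbhs_singleton (model_near_slice mod).
have [_ [U0 N0 _]] := nbhs_singleton nt.
have [dg Cg1] := model_Ckg mod 2%N; have [dh _] := model_Ckh mod 1%N.
have [dg2 _] := Cg1 (0, 1).
have cP r := @phase_coord_continuous R n r.
have dF := is_derive_boundary_sum mod.
have dK : is_derive (0 : R) (1 : R) (fun s => \sum_k phase_coord (false, k) (g (s, t0)) *
    phase_coord (true, k) ('D_(0, 1) g (s, t0)))
  (\sum_k phase_coord (false, k) ('D_(1, 0) g (0, t0)) *
           phase_coord (true, k) ('D_(0, 1) g (0, t0)) +
   \sum_k phase_coord (false, k) (g (0, t0)) *
           phase_coord (true, k) ('D_(1, 0) ('D_(0, 1) g) (0, t0))).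
  apply: is_derive_dot => k.
    exact: (is_derive_linear_comp (cP _) (is_derive_slice1 (dg _ U0))).
  exact: (is_derive_linear_comp (cP _) (is_derive_slice1 (dg2 _ U0))).
have [D dE DE] : exists2 D, is_derive (0 : R) (1 : R) (fun s => H s (c s 0)) D &
    D = 'd h (g (0, t0), 0) ('D_(1, 0) g (0, t0), 1).
  by eexists; first exact: is_derive_energy mod t01'.
have dE2 := is_deriveM (is_derive_cst (2 : R) (0 : R) (1 : R)) dE.
have td := time_derivative_model mod t01.
(* 2 E = xi . x_t, by Euler's identity and Hamilton's equation for x. *)
have kinetic : \forall s \near (0 : R),
    (cst 2 * (fun s => H s (c s 0))) s = \sum_k phase_coord (false, k) (g (s, t0)) *
    phase_coord (true, k) ('D_(0, 1) g (s, t0)).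
  apply: filterS td => s [dhs [se is_ gE dhE zE]].
  have [cs0 _] := c_bichar se t01'.
  have euler := euler_identity (H_homogeneous se) is_ cs0 dhE.
  rewrite (energy_is_constant se t01') (differential_pairing _ zE) in euler.
  apply: etrans (esym euler) _.
  apply: eq_bigr => k _ /=; rewrite mxE mul0r subr0 -gE; congr (_ * _).
have [_ EE] := dE; have [_ EE2] := dE2; have [_ EK] := dK.
have E2 := near_eq_derive (1 : R) kinetic.
have nearF : \forall t \near t0, \sum_k phase_coord (false, k) (g (0, t)) *
    phase_coord (true, k) ('D_(1, 0) g (0, t)) = boundary_term t.
  apply: filterS2 (nbhs_segment t01) (boundary_term_model mod) => t /=.
  by rewrite in_itv /= => t01t /(_ t01t) ->.
apply: (near_eq_is_derive nearF); apply: is_derive_eq dF _.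
have [dhs [_ _ gE dhE zE]] := nbhs_singleton td.
have Ps := nbhs_singleton (param_deriv_model mod) t01'.
have twice := etrans (esym EE2) (etrans E2 EK).
rewrite EE Ps (deriveE _ (dh _ N0)).
have twoD : 2 * D = cst 2 (0 : R) *: D + H 0 (c 0 0) *: 0 by rewrite scaler0 addr0.
apply: (energy_variation_split erefl (etrans twoD twice)).
- have mixed : 'D_(0, 1) ('D_(1, 0) g) (0, t0) = 'D_(1, 0) ('D_(0, 1) g) (0, t0).
    exact: (@mixed_phase_derivatives_commute R n _ g U (0, t0) (0, 1) (1, 0)
      (model_openU mod) U0 (model_Ckg mod 2%N)).
  apply: eq_bigr => k _.
  exact: (congr1 (fun z => phase_coord (false, k) (g (0, t0)) *
    phase_coord (true, k) z) mixed).
rewrite DE.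
(* It remains to identify the part of E' that comes from the variation of the
   curve: dH (x_s, xi_s) = xi_s . x_t - x_s . xi_t. *)
set v := 'D_(1, 0) g (0, t0).
have -> : (v, 1 : R) = (v, 0) + (0, 1) by congr pair; rewrite /= ?addr0 ?add0r.
rewrite linearD; congr (_ + _).
have [dsl <-] := diff_slice v (dh _ N0).
have [ct0 _] := c_bichar eps0 t01'.
have Dz : diff_on (canonical_dom i) (local_expr (H 0) i) (canonical_coord i (c 0 t0))
    ('d (fun z => h (z, 0)) (g (0, t0))).
  rewrite gE; exists (fun z => h (z, 0)); split => //.
  rewrite near_withinE.
  have cz : (z, 0 : R) @[z --> g (0, t0)] --> (g (0, t0), 0 : R).
    apply: (@cvg_pair _ _ _ (nbhs (g (0, t0))) (nbhs (g (0, t0))) (nbhs (0 : R))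
      _ _ _ id (fun=> 0)); [exact: cvg_id|exact: cvg_cst].
  have nN : nbhs (g (0, t0), 0 : R) N.
    by apply: open_nbhs_nbhs; split => //; exact: model_openN mod.
  have nNz : \forall z \near g (0, t0), N (z, 0) by exact: (cz _ nN).
  by apply: filterS nNz => z Nz iz; exact: (model_h mod).
rewrite -(canonical_dom_unique (canonical_coord_dom it ct0) dhE Dz).
rewrite (differential_pairing _ zE) -sumrB; apply: eq_bigr => k _.
by congr (_ - _); rewrite mulrC.
Qed.

Lemma boundary_term_continuous : {within `[0, 1], continuous boundary_term}.
Proof.
apply/subspace_continuousP => t /= tA; have t01 : 0 <= t <= 1 by rewrite in_itv in tA.
have [i it] := dom_cover (base (c 0 t)).
have [U [g [N [h mod]]]] := chart_model_exists t01 it.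
have dF := is_derive_boundary_sum mod.
apply: (within_continuous_near _ _ (is_derive_continuous dF)) => //.
by apply: filterS (boundary_term_model mod) => u E; rewrite /= in_itv.
Qed.

Lemma param_deriv_continuous :
  {within `[0, 1], continuous (fun t => param_deriv H (c 0 t) 0)}.
Proof.
apply/subspace_continuousP => t /= tA; have t01 : 0 <= t <= 1 by rewrite in_itv in tA.
have [i it] := dom_cover (base (c 0 t)).
have [U [g [N [h mod]]]] := chart_model_exists t01 it.
have [_ [U0 N0 _]] := nbhs_singleton (nbhs_singleton (model_near_slice mod)).
have [dg _] := model_Ckg mod 1%N; have [_ Ch] := model_Ckh mod 1%N.
apply: (@within_continuous_near _ `[0, 1] (fun t => param_deriv H (c 0 t) 0)
  (fun t => 'D_(0, 1) h (g (0, t), 0))) => //.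
  by apply: filterS (param_deriv_model mod) => u E; rewrite /= in_itv.
have cg := is_derive_continuous (is_derive_slice2 (dg _ U0)).
apply: (@cvg_comp _ _ _ (fun t => (g (0, t), 0 : R)) ('D_(0, 1) h) _
  (nbhs (g (0, t), 0 : R))).
  apply: (@cvg_pair _ _ _ (nbhs t) (nbhs (g (0, t))) (nbhs (0 : R)) _ _ _
    (fun t => g (0, t)) (fun=> 0)); [exact: cg|exact: cvg_cst].
exact: (Ch (0, 1) _ N0).
Qed.

Context (c_start : forall s, `|s| < eps -> base (c s 0) = base (c 0 0))
  (c_end : forall s, `|s| < eps -> base (c s 1) = base (c 0 1)).

(** The boundary terms vanish because the end points are fixed. The scaling a
    is 1 for the bicharacteristic parameterized by [0, 1], and the inverse of the
    travel time for the unit one. *)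
Lemma integral_param_deriv (a : R) : 0 < a ->
  (\int[lebesgue_measure]_(t in `[0, a^-1]) (a ^+ 2 * param_deriv H (c 0 (a * t)) 0)) =
  - (a * 'D_1 (fun s => H s (c s 0)) 0).
Proof.
move=> a0; set e := 'D_1 (fun s : R => H s (c s 0)) (0 : R).
pose phi := boundary_term.
pose hs t := param_deriv H (c 0 t) 0.
have phi0 : phi 0 = 0.
  have [i it] := dom_cover (base (c 0 0)).
  have t01 : 0 <= (0 : R) <= 1 by rewrite lexx ler01.
  rewrite /phi (boundary_termE t01 it).
  exact: (momentum_variation_fixed t01 it c_start).
have phi1 : phi 1 = 0.
  have [i it] := dom_cover (base (c 0 1)).
  have t01 : 0 <= (1 : R) <= 1 by rewrite lexx ler01.
  rewrite /phi (boundary_termE t01 it).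
  exact: (momentum_variation_fixed t01 it c_end).
have a1 : 0 < a^-1 by rewrite invr_gt0.
(* F is the primitive of the integrand given by is_derive_boundary_term. *)
pose F t := a * (phi (a * t) - e * (a * t)).
have dF t : t \in `]0, a^-1[ -> is_derive t (1 : R) F (a ^+ 2 * hs (a * t)).
  rewrite in_itv /= => /andP[t0 ta].
  have at01 : 0 < a * t < 1.
    by rewrite mulr_gt0 //= -(divff (lt0r_neq0 a0)) ltr_pM2l.
  have dphi := is_derive_boundary_term at01.
  have da : is_derive t (1 : R) (fun t => a * t) a.
    apply: is_derive_eq (is_deriveM (is_derive_cst a t 1) (is_derive_id t 1)) _.
    by rewrite scaler0 addr0; exact: mulr1.
  have dpa := is_derive1_comp dphi da.
  have dea := is_deriveM (is_derive_cst e t 1) da.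
  have dd := is_deriveM (is_derive_cst a t 1) (is_deriveB dpa dea).
  apply: is_derive_eq dd _.
  rewrite !scaler0 !addr0 /GRing.scale /= -/e -/(hs (a * t)); ring.
have cphi : {within `[0, a^-1], continuous (fun t => phi (a * t))}.
  exact: within_continuous_scale a0 boundary_term_continuous.
have chs : {within `[0, a^-1], continuous (fun t => hs (a * t))}.
  exact: within_continuous_scale a0 param_deriv_continuous.
have clin : continuous (fun t : R => e * (a * t)).
  by move=> t; apply: cvgM; [exact: cvg_cst|apply: cvgM; [exact: cvg_cst|exact: cvg_id]].
have cF : {within `[0, a^-1], continuous F}.
  move=> t; apply: cvgM; first exact: cvg_cst.
  by apply: cvgB; [exact: cphi|exact: (continuous_subspaceT clin)].
have cf : {within `[0, a^-1], continuous (fun t => a ^+ 2 * hs (a * t))}.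
  by move=> t; apply: cvgM; [exact: cvg_cst|exact: chs].
have [_ F0 F1] := (continuous_within_itvP _ a1).1 cF.
have dF' : derivable_oo_LRcontinuous F 0 a^-1.
  by split => // t tA; have [] := dF t tA.
have F'E : {in `]0, a^-1[, F^`()%classic =1 (fun t => a ^+ 2 * hs (a * t))}.
  by move=> t tA; rewrite derive1E; have [_ ->] := dF t tA.
rewrite /Rintegral (continuous_FTC2 a1 cf dF' F'E) /=.
by rewrite /F mulr0 mulfV ?lt0r_neq0 // phi0 phi1; ring.
Qed.

Lemma is_derive_energy_integral :
  is_derive (0 : R) (1 : R) (fun s => H s (c s 0))
    (- \int[lebesgue_measure]_(t in `[0, 1]) param_deriv H (c 0 t) 0).
Proof.
have I1 := integral_param_deriv ltr01.
rewrite mul1r invr1 in I1.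
have -> : - (\int[lebesgue_measure]_(t in `[0, 1]) param_deriv H (c 0 t) 0) =
    'D_1 (fun s => H s (c s 0)) 0.
  apply/eqP; rewrite eqr_oppLR -I1; apply/eqP.
  by apply: eq_Rintegral => t _; rewrite expr1n !mul1r.
have [i it] := dom_cover (base (c 0 0)).
have t01 : 0 <= (0 : R) <= 1 by rewrite lexx ler01.
have [U [g [N [h mod]]]] := chart_model_exists t01 it.
have [d _] := is_derive_energy mod t01.
exact: derivableP.
Qed.

End Variation.

Theorem corollary3p1 (R : realType) (n : nat) (n_ge2 : (2 <= n)%N)
  (M : manifold R n) (eps : R) (eps_gt0 : 0 < eps)
  (H : R -> cotangent M -> R)
  (H_smooth : smooth_family eps H)
  (H_ham : forall s, `|s| < eps -> hamiltonian (H s))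
  (x1 x2 : M) (p1 : cotangent M) (p1_base : base p1 = x1)
  (p1_not_conj : not_conjugate (H 0) p1 x2)
  (c : R -> R -> cotangent M)
  (c_smooth : smooth_map [set w : R * R | `|w.1| < eps /\ 0 <= w.2 <= 1]
                         (fun w => c w.1 w.2))
  (c_bichar : forall s, `|s| < eps -> bicharacteristic (H s) 1 (c s))
  (c_init : c 0 0 = p1)
  (c_start : forall s, `|s| < eps -> base (c s 0) = x1)
  (c_end : forall s, `|s| < eps -> base (c s 1) = x2) :
  let T := fun s : R => hnorm (H s) (c s 0) in
  is_derive (0 : R) (1 : R) (fun s => 2^-1 * T s ^+ 2)
    (- \int[lebesgue_measure]_(t in `[0, 1]) param_deriv H (c 0 t) 0) /\
  (exists gamma : R -> cotangent M, unit_bicharacteristic (H 0) p1 x2 gamma) /\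
  (forall gamma : R -> cotangent M, unit_bicharacteristic (H 0) p1 x2 gamma ->
    is_derive (0 : R) (1 : R) T
      (- \int[lebesgue_measure]_(t in `[0, T 0]) param_deriv H (gamma t) 0)).
Proof.
move=> T.
have e00 : `|0 : R| < eps by rewrite normr0.
have hom s : `|s| < eps -> forall (a : R) p, 0 < a -> nonzero p ->
  H s (Defs.cscale a p) = a ^+ 2 * H s p by move=> /H_ham [].
have starts s : `|s| < eps -> base (c s 0) = base (c 0 0).
  by move=> se; rewrite !c_start.
have ends s : `|s| < eps -> base (c s 1) = base (c 0 1).
  by move=> se; rewrite !c_end.
have t00 : 0 <= (0 : R) <= 1 by rewrite lexx ler01.
have nz s t : `|s| < eps -> 0 <= t <= 1 -> nonzero (c s t).
  by move=> se t01; have [] := c_bichar s se t t01.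
have E_gt0 s : `|s| < eps -> 0 < H s (c s 0).
  by move=> se; have [_ pos _ _] := H_ham s se; apply: pos; exact: nz.
have neps : \forall s \near (0 : R), `|s| < eps := nbhs0_lt eps_gt0.
have T2 s : `|s| < eps -> T s ^+ 2 = 2 * H s (c s 0).
  by move=> se; rewrite /T /hnorm sqr_sqrtr // mulr_ge0 // ltW // E_gt0.
have dE := is_derive_energy_integral eps_gt0 H_smooth c_smooth c_bichar hom starts ends.
have T_gt0 : 0 < T 0 by rewrite sqrtr_gt0 mulr_gt0 // E_gt0.
(* The unit bicharacteristic is c 0 rescaled by a = 1 / T. *)
pose a := (T 0)^-1.
have a_gt0 : 0 < a by rewrite invr_gt0.
pose delta t := Defs.cscale a (c 0 (a * t)).
have seg t : 0 <= t <= T 0 -> 0 <= a * t <= 1.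
  move=> /andP[t0 tT]; rewrite mulr_ge0 ?(ltW a_gt0) //=.
  by rewrite /a mulrC ler_pdivrMr // mul1r.
have delta_unit : unit_bicharacteristic (H 0) p1 x2 delta.
  rewrite /unit_bicharacteristic -c_init -[hnorm _ _]/(T 0); split.
  - have := rescaled_bicharacteristic (hom 0 e00) a_gt0 (c_bichar 0 e00).
    by rewrite /a div1r invrK.
  - move=> t /seg t01; rewrite /delta hom //; last exact: nz.
    rewrite (energy_conserved (c_bichar 0 e00) t01).
    have E0 : H 0 (c 0 0) != 0 by rewrite gt_eqF // E_gt0.
    by rewrite /a exprVn T2 // invfM divfK.
  - by rewrite /delta mulr0.
  - by rewrite /delta /a mulVf ?gt_eqF //= c_end.
split.
  apply: (near_eq_is_derive _ dE); apply: filterS neps => s se.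
  by rewrite T2 // mulKf.
split; first by exists delta.
move=> gamma [gb _ g0 _]; rewrite -c_init -/(T 0) in gb g0.
have [db _ d0 _] := delta_unit; rewrite -c_init -/(T 0) in db d0.
have gE t : 0 <= t <= T 0 -> gamma t = delta t.
  have [sm _ _ _] := H_ham 0 e00.
  by apply: (bicharacteristic_uniqueness sm gb db); rewrite g0 d0.
have Ia := integral_param_deriv eps_gt0 H_smooth c_smooth c_bichar hom starts ends a_gt0.
have -> : (\int[lebesgue_measure]_(t in `[0, T 0]) param_deriv H (gamma t) 0) =
    - (a * 'D_1 (fun s => H s (c s 0)) 0).
  rewrite -Ia {1}/a invrK; apply: eq_Rintegral => t.
  rewrite inE /= in_itv /= => tT; rewrite gE //.
  exact: (param_deriv_cscale eps_gt0 H_smooth c_smooth c_bichar hom a_gt0 (seg t tT)).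
have [dE0 EE] := dE.
have dE' : is_derive (0 : R) (1 : R) (fun s => H s (c s 0))
  ('D_1 (fun s => H s (c s 0)) 0) by exact: derivableP.
have d2E := is_deriveM (is_derive_cst (2 : R) (0 : R) (1 : R)) dE'.
have E2_gt0 : 0 < 2 * H 0 (c 0 0) by rewrite mulr_gt0 // E_gt0.
have dT := @is_derive1_comp _ Num.sqrt (fun s => 2 * H s (c s 0)) 0 _ _
  (is_derive1_sqrt E2_gt0) d2E.
apply: is_derive_eq dT _.
rewrite scaler0 addr0 opprK.
have halve (x y : R) : (2 * x)^-1 * (2 * y) = x^-1 * y.
  by rewrite invfM mulrACA mulVf // mul1r.
exact: halve.
Qed.
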